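(* Let $H$ be a finite-dimensional semisimple Hopf algebra over $\mathbb{C}$, $\chi_i$ the character of an irreducible $H$-module $V_i$, and $F_j$ a central primitive idempotent of $R(H)$. Then the following are equivalent: (i) $F_j\chi_i=\langle\chi_i,1\rangle F_j$; (ii) $\langle\chi_i,\eta_j\rangle=m_j\langle\chi_i,1\rangle$; (iii) $\mathfrak{C}^j\subset\mathrm{LKer}_{V_i}$.
   Context: $d=\dim H$. $\Lambda\in H$ is the (two-sided) integral of $H$ and $\lambda\in H^*$ the integral of $H^*$ with $\langle\lambda,\Lambda\rangle=1$. For $h\in H$, $p\in H^*$, $h\leftharpoonup p=\sum\langle p,h_1\rangle h_2$. $R(H)\subset H^*$ is the span of the irreducible characters of $H$. $F_0=\frac1d\lambda,\dots,F_{m-1}$ are the central primitive idempotents of $R(H)$; $f_j\in R(H)$ is a primitive idempotent with $f_jF_j=f_j$, $m_j=\dim f_jR(H)$, and $\eta_j=\frac{1}{\dim(f_jH^* )}(\Lambda\leftharpoonup dF_j)$. $\mathfrak{C}^j=\Lambda\leftharpoonup F_jH^*=\{\Lambda\leftharpoonup F_jp\mid p\in H^*\}$. For a left $H$-module $V$, $\mathrm{LKer}_V=\{h\in H\mid\sum h_1\otimes h_2\cdot v=h\otimes v\ \forall v\in V\}$. *)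

(* Defs.v *)
(* A finite-dimensional Hopf algebra is presented by its
   structure constants with respect to a basis (e_i)_{i < d} of H.
     - elements of H            : 'rV[K]_d        (coordinates h_i)
     - elements of H (x) H      : 'M[K]_d         (T = sum_{i,j} T i j e_i (x) e_j)
     - elements of H^*          : 'rV[K]_d        (p_i = <p, e_i>)
     - a left H-module V of dimension n : matrices rho_i : 'M_n giving the
       action of e_i on column vectors 'cV_n.                                *)
From HB Require Import structures.
From mathcomp Require Import all_boot all_order all_algebra.

Set Implicit Arguments.
Unset Strict Implicit.
Unset Printing Implicit Defensive.

Import Order.TTheory GRing.Theory Num.Theory.
Local Open Scope ring_scope.

Section Hopf.
Variables (K : fieldType) (d : nat).

Record hopf_data := HopfData {
  mulc    : 'I_d -> 'I_d -> 'rV[K]_d;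
  unitc   : 'rV[K]_d;
  comulc  : 'I_d -> 'M[K]_d;
  counitc : 'rV[K]_d;
  antic   : 'M[K]_d
}.

Variable A : hopf_data.

Definition hmul (a b : 'rV[K]_d) : 'rV[K]_d :=
  \sum_(i < d) \sum_(j < d) (a 0 i * b 0 j) *: mulc A i j.
Definition hone : 'rV[K]_d := unitc A.
Definition comul (h : 'rV[K]_d) : 'M[K]_d := \sum_(k < d) h 0 k *: comulc A k.
Definition counit (h : 'rV[K]_d) : K := \sum_(i < d) h 0 i * counitc A 0 i.
Definition antipode (h : 'rV[K]_d) : 'rV[K]_d := h *m antic A.
Definition basis_vec (i : 'I_d) : 'rV[K]_d := delta_mx 0 i.

(* multiplication on H (x) H : (x (x) y)(x' (x) y') = x x' (x) y y' *)
Definition tmul (T U : 'M[K]_d) : 'M[K]_d :=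
  \matrix_(a, b) \sum_(i < d) \sum_(j < d) \sum_(i' < d) \sum_(j' < d)
     T i j * U i' j' * (mulc A i i' 0 a * mulc A j j' 0 b).

Definition tmult (T : 'M[K]_d) : 'rV[K]_d :=
  \sum_(i < d) \sum_(j < d) T i j *: hmul (basis_vec i) (basis_vec j).

Definition S_id (T : 'M[K]_d) : 'M[K]_d := (antic A)^T *m T.
Definition id_S (T : 'M[K]_d) : 'M[K]_d := T *m antic A.

Definition is_hopf : Prop :=
      (forall a b c, hmul (hmul a b) c = hmul a (hmul b c)) /\
      (forall a, hmul hone a = a /\ hmul a hone = a) /\
      (forall h a b c,
         \sum_(i < d) comul h i c * comulc A i a b =
         \sum_(j < d) comul h a j * comulc A j b c) /\
      (forall h c, \sum_(i < d) counitc A 0 i * comul h i c = h 0 c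
                /\ \sum_(j < d) comul h c j * counitc A 0 j = h 0 c) /\
      ((forall a b, comul (hmul a b) = tmul (comul a) (comul b))
        /\ comul hone = hone^T *m hone) /\
      ((forall a b, counit (hmul a b) = counit a * counit b) /\ counit hone = 1) /\
      (forall h, tmult (S_id (comul h)) = counit h *: hone
              /\ tmult (id_S (comul h)) = counit h *: hone).

(* A left ideal of H is a subspace (row space of an 'M_d) stable under
   left multiplication. H is semisimple iff every left ideal has a
   complementary left ideal (H is completely reducible as a left module). *)
Definition left_ideal (U : 'M[K]_d) : Prop :=
  forall h u : 'rV[K]_d, (u <= U)%MS -> (hmul h u <= U)%MS.

Definition semisimple : Prop :=
  forall U : 'M[K]_d, left_ideal U ->
    exists W : 'M[K]_d, left_ideal W /\
      (U :&: W == (0 : 'M[K]_d))%MS /\ (U + W == 1%:M)%MS.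

Record hmodule := HModule { mdim : nat; mact : 'I_d -> 'M[K]_mdim }.

Definition rep (V : hmodule) (h : 'rV[K]_d) : 'M[K]_(mdim V) :=
  \sum_(i < d) h 0 i *: mact V i.

Definition is_module (V : hmodule) : Prop :=
  (forall a b, rep V (hmul a b) = rep V a *m rep V b) /\ rep V hone = 1%:M.

(* a subspace U of V (row space; its rows are the transposes of vectors of
   V) is a submodule if it is stable under the action *)
Definition submodule (V : hmodule) (U : 'M[K]_(mdim V)) : Prop :=
  forall h, (U *m (rep V h)^T <= U)%MS.

Definition irreducible (V : hmodule) : Prop :=
  [/\ is_module V, (0 < mdim V)%N &
      forall U : 'M[K]_(mdim V), submodule U -> (U == (0 : 'M[K]_(mdim V)))%MS \/ (U == 1%:M)%MS].

Definition pair (p h : 'rV[K]_d) : K := \sum_(i < d) p 0 i * h 0 i.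

Definition character (V : hmodule) : 'rV[K]_d := \row_(i < d) \tr (mact V i).

Definition conv (p q : 'rV[K]_d) : 'rV[K]_d :=
  \row_(k < d) \sum_(i < d) \sum_(j < d) comulc A k i j * p 0 i * q 0 j.

Definition harp (h p : 'rV[K]_d) : 'rV[K]_d :=
  \row_(b < d) \sum_(a < d) p 0 a * comul h a b.

Definition inRH (p : 'rV[K]_d) : Prop :=
  exists (m : nat) (Vs : 'I_m -> hmodule) (c : 'I_m -> K),
    (forall k, irreducible (Vs k)) /\ p = \sum_(k < m) c k *: character (Vs k).

Definition idem (P : 'rV[K]_d -> Prop) (e : 'rV[K]_d) : Prop :=
  [/\ P e, conv e e = e & e != 0].

Definition central_RH (p : 'rV[K]_d) : Prop :=
  forall q, inRH q -> conv p q = conv q p.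

Definition central_primitive_idem (F : 'rV[K]_d) : Prop :=
  [/\ idem inRH F, central_RH F &
      ~ exists E1 E2, [/\ idem inRH E1 /\ central_RH E1,
                          idem inRH E2 /\ central_RH E2,
                          conv E1 E2 = 0, conv E2 E1 = 0
                        & F = E1 + E2]].

Definition primitive_idem (f : 'rV[K]_d) : Prop :=
  idem inRH f /\
  ~ exists e1 e2, [/\ idem inRH e1, idem inRH e2, conv e1 e2 = 0,
                      conv e2 e1 = 0 & f = e1 + e2].

Definition has_dim (P : 'rV[K]_d -> Prop) (n : nat) : Prop :=
  exists B : 'M[K]_(n, d), row_free B /\ (forall v, P v <-> (v <= B)%MS).

Definition integral_H (L : 'rV[K]_d) : Prop :=
  forall h, hmul h L = counit h *: L /\ hmul L h = counit h *: L.
Definition integral_Hstar (l : 'rV[K]_d) : Prop :=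
  forall p, conv p l = pair p hone *: l /\ conv l p = pair p hone *: l.

(* LKer_V = { h | sum h_1 (x) h_2 . v = h (x) v for all v in V } ;
   the component along e_a of the tensor identity is written out *)
Definition LKer (V : hmodule) (h : 'rV[K]_d) : Prop :=
  forall (v : 'cV[K]_(mdim V)) (a : 'I_d),
    \sum_(b < d) comul h a b *: (mact V b *m v) = h 0 a *: v.

End Hopf.

(* Main.v *)
(** By Larson and Radford, [S ^ 2 = 1]: the integrals give [S ^ 4 = 1] and the
    trace formula [Tr (S ^ 2) = d * counit Lam]; moreover [counit Lam] is the
    trace of [S ^ 2] on the image of the idempotent [chi_reg / d], hence a nonzero
    integer, so that [|Tr (S ^ 2)| <= d] forces [S ^ 2 = 1].  It follows that
    [d Lam] is the regular character of [H^*] and that [(p, q) |-> <p q, Lam>] is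
    symmetric and nondegenerate on [R(H)].  Therefore [f R(H) f] is the line
    spanned by [f], and [F = sum_i a_i b_i] for dual bases [a_i] of [R(H) f] and
    [b_i] of [f R(H)], with [b_j a_i = delta_ij f].  Writing
    [b_j chi a_i = beta_ij f], condition (ii) says [Tr beta = m n], where
    [n = dim V], and (i) gives [beta_ii = n].

    For (ii) -> (iii), let [z] be central in [H] and let [z^*] act on each simple
    module by the conjugate scalar.  On [H (x) V], [Delta z] and [z (x) 1] are
    commuting normal operators, so the trace of [|Delta z - z (x) 1| ^ 2] is
    nonnegative and vanishes only if [z] lies in [LKer V].  Summed over an
    orthonormal basis of the span of the [Lam <- a_i], these traces give
    [2 m n - 2 Re (Tr beta) = 0].  Taking traces over [V] yields (iii) -> (i). *)

(* [hopf_data] carries no star operation and modules carry no inner product, so positivity has to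
   come from elsewhere. Conjugation is defined on central elements alone, through their spectral
   idempotents, and the trace of a product of commuting projections is a rank, hence a natural
   number.

   Semisimplicity enters through [counit A Lam != 0]. What upgrades this to S ^ 2 = 1 is
   integrality: Tr (S ^ 2) is [d] times a nonzero integer, yet S ^ 2 is an involution of a space of
   dimension [d]. In turn S ^ 2 = 1 makes Delta Lam symmetric, so that evaluation at [Lam] is a
   trace on the dual algebra, and makes Lam <- p central for [p] in R(H): this is the bridge between
   R(H), where (i) and (ii) live, and the center of H, where the Hermitian form lives.

   That f R(H) f is a line is obtained from two facts: primitivity of [f] makes this corner local,
   and a nilpotent element of it is orthogonal to all of R(H) for the trace form. *)
Require Import Defs.
From HB Require Import structures.
From mathcomp Require Import all_boot all_order all_algebra.
From mathcomp Require Import boolp ring zify mxtens mxrepresentation spectral.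
Set Implicit Arguments.
Unset Strict Implicit.
Unset Printing Implicit Defensive.
Import Order.TTheory GRing.Theory Num.Theory.
Local Open Scope ring_scope.

(** * Structure constants *)

Section StructureConstants.
Variables (K : fieldType) (d : nat) (A : hopf_data K d).
Local Notation E i := (basis_vec K i).

(* Elements are row vectors, so [mulL] and [convL] reverse products, whereas
   [mulR] preserves them. *)
Definition mulL (h : 'rV[K]_d) : 'M[K]_d :=
  \matrix_(j, b) \sum_i h 0 i * mulc A i j 0 b.
Definition mulR (h : 'rV[K]_d) : 'M[K]_d :=
  \matrix_(i, b) \sum_j h 0 j * mulc A i j 0 b.
Definition convL (p : 'rV[K]_d) : 'M[K]_d :=
  \matrix_(j, k) \sum_i comulc A k i j * p 0 i.

Lemma mulLE h x : hmul A h x = x *m mulL h.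
Proof.
apply/rowP=> b; rewrite [RHS]mxE summxE.
under eq_bigr do rewrite summxE.
rewrite exchange_big /=; apply: eq_bigr => j _; rewrite [in RHS]mxE mulr_sumr.
by apply: eq_bigr => i _; rewrite !mxE mulrA [x _ _ * _]mulrC.
Qed.

Lemma mulRE h x : hmul A x h = x *m mulR h.
Proof.
apply/rowP=> b; rewrite [RHS]mxE summxE; apply: eq_bigr => i _.
rewrite summxE [in RHS]mxE mulr_sumr; apply: eq_bigr => j _.
by rewrite !mxE mulrA.
Qed.

Lemma convLE p q : conv A p q = q *m convL p.
Proof.
apply/rowP=> k; rewrite !mxE exchange_big /=; apply: eq_bigr => j _.
by rewrite mxE mulr_sumr; apply: eq_bigr => i _; rewrite mulrC.
Qed.

Lemma mulL_is_linear : linear mulL.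
Proof.
move=> a x y; apply/matrixP=> j b; rewrite !mxE mulr_sumr -big_split /=.
by apply: eq_bigr => i _; rewrite !mxE mulrDl mulrA.
Qed.
HB.instance Definition _ :=
  GRing.isLinear.Build K 'rV[K]_d 'M[K]_d _ mulL mulL_is_linear.

Lemma mulR_is_linear : linear mulR.
Proof.
move=> a x y; apply/matrixP=> j b; rewrite !mxE mulr_sumr -big_split /=.
by apply: eq_bigr => i _; rewrite !mxE mulrDl mulrA.
Qed.
HB.instance Definition _ :=
  GRing.isLinear.Build K 'rV[K]_d 'M[K]_d _ mulR mulR_is_linear.

Lemma convL_is_linear : linear convL.
Proof.
move=> a x y; apply/matrixP=> j b; rewrite !mxE mulr_sumr -big_split /=.
by apply: eq_bigr => i _; rewrite !mxE mulrDr mulrCA.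
Qed.
HB.instance Definition _ :=
  GRing.isLinear.Build K 'rV[K]_d 'M[K]_d _ convL convL_is_linear.

Lemma comul_is_linear : linear (comul A).
Proof.
move=> a x y; rewrite /comul scaler_sumr -big_split; apply: eq_bigr => i _.
by rewrite !mxE scalerDl scalerA.
Qed.
HB.instance Definition _ :=
  GRing.isLinear.Build K 'rV[K]_d 'M[K]_d _ (comul A) comul_is_linear.

Lemma comulE h i j : comul A h i j = \sum_k h 0 k * comulc A k i j.
Proof. by rewrite summxE; apply: eq_bigr => k _; rewrite mxE. Qed.

Lemma comul_basis k : comul A (E k) = comulc A k.
Proof.
apply/matrixP=> i j; rewrite comulE (bigD1 k) //= mxE !eqxx mul1r big1 ?addr0 //.
by move=> l lk; rewrite mxE (negPf lk) andbF mul0r.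
Qed.

Lemma row_sum_basis (x : 'rV[K]_d) : x = \sum_i x 0 i *: E i.
Proof. exact: row_sum_delta. Qed.

Lemma linear_basis (V : lmodType K) (f : {linear 'rV[K]_d -> V}) x :
  f x = \sum_i x 0 i *: f (E i).
Proof.
rewrite {1}(row_sum_basis x) linear_sum; apply: eq_bigr => i _.
by rewrite linearZ.
Qed.

Lemma basis_mulmx n i (M : 'M[K]_(d, n)) : E i *m M = row i M.
Proof. by rewrite -rowE. Qed.

Lemma entry_basis (M : 'M[K]_d) i j : M i j = (E i *m M *m (E j)^T) 0 0.
Proof. by rewrite basis_mulmx trmx_delta -colE !mxE. Qed.

Lemma pairE (p h : 'rV[K]_d) : pair p h = (p *m h^T) 0 0.
Proof. by rewrite mxE; apply: eq_bigr => i _; rewrite mxE. Qed.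

Lemma pairC (p h : 'rV[K]_d) : pair p h = pair h p.
Proof. by apply: eq_bigr => i _; rewrite mulrC. Qed.

Lemma counitE h : counit A h = pair (counitc A) h.
Proof. by apply: eq_bigr => i _; rewrite mulrC. Qed.

Lemma pair_basis (p : 'rV[K]_d) i : pair p (E i) = p 0 i.
Proof.
rewrite /pair (bigD1 i) //= mxE !eqxx mulr1 big1 ?addr0 // => j ji.
by rewrite mxE (negPf ji) andbF mulr0.
Qed.

Lemma pairDr p x y : @pair K d p (x + y) = pair p x + pair p y.
Proof. by rewrite /pair -big_split; apply: eq_bigr => i _; rewrite mxE mulrDr. Qed.

Lemma pairZr p a x : @pair K d p (a *: x) = a * pair p x.
Proof. by rewrite /pair mulr_sumr; apply: eq_bigr => i _; rewrite mxE mulrCA. Qed.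

Lemma pairDl p q x : @pair K d (p + q) x = pair p x + pair q x.
Proof. by rewrite ![pair _ x]pairC pairDr. Qed.

Lemma pairZl p a x : @pair K d (a *: p) x = a * pair p x.
Proof. by rewrite ![pair _ x]pairC pairZr. Qed.

Lemma pair0l x : @pair K d 0 x = 0.
Proof. by rewrite -(scale0r (0 : 'rV_d)) pairZl mul0r. Qed.

Lemma pair_suml I r (P : pred I) (F : I -> 'rV[K]_d) x :
  pair (\sum_(i <- r | P i) F i) x = \sum_(i <- r | P i) pair (F i) x.
Proof. exact: (big_morph (fun p => pair p x) (fun p q => pairDl p q x) (pair0l x)). Qed.

Lemma pair_sumr I r (P : pred I) (F : I -> 'rV[K]_d) x :
  pair x (\sum_(i <- r | P i) F i) = \sum_(i <- r | P i) pair x (F i).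
Proof. by rewrite pairC pair_suml; apply: eq_bigr => i _; rewrite pairC. Qed.

Lemma pair_inj (p q : 'rV[K]_d) : (forall x, pair p x = pair q x) -> p = q.
Proof. by move=> pq; apply/rowP=> i; rewrite -!pair_basis pq. Qed.

Lemma pair_conv p q h : pair (conv A p q) h = (p *m comul A h *m q^T) 0 0.
Proof.
rewrite mxE /pair; under eq_bigr do rewrite mxE mulr_suml.
rewrite exchange_big /=.
transitivity (\sum_i \sum_j p 0 i * comul A h i j * q 0 j).
  apply: eq_bigr => i _.
  under eq_bigr do rewrite mulr_suml.
  rewrite exchange_big /=; apply: eq_bigr => j _.
  rewrite comulE mulr_sumr mulr_suml; apply: eq_bigr => k _.
  by rewrite mulrAC [h 0 k * _]mulrC mulrCA !mulrA; congr (_ * _); rewrite -!mulrA mulrCA !mulrA.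
rewrite exchange_big /=; apply: eq_bigr => j _.
by rewrite !mxE mulr_suml.
Qed.

Lemma harpE h p : harp A h p = p *m comul A h.
Proof. by apply/rowP=> b; rewrite !mxE. Qed.

Lemma pair_harp q p h : pair q (harp A h p) = pair (conv A p q) h.
Proof.
by rewrite pair_conv harpE pairC pairE.
Qed.

(** Left multiplication of a tensor [U] by x (x) y is the sandwich by [(mulL x)^T] and [mulL y], so
    identities in H (x) H become matrix identities. *)
Lemma tmulE (T U : 'M[K]_d) : tmul A T U =
  \sum_i \sum_j T i j *: ((mulL (E i))^T *m U *m mulL (E j)).
Proof.
have mLe i j b : mulL (E i) j b = mulc A i j 0 b.
  rewrite mxE (bigD1 i) //= mxE !eqxx mul1r big1 ?addr0 // => k ki.
  by rewrite mxE (negPf ki) andbF mul0r.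
apply/matrixP=> a b; rewrite mxE summxE; apply: eq_bigr => i _.
rewrite summxE; apply: eq_bigr => j _; rewrite !mxE exchange_big mulr_sumr /=.
apply: eq_bigr => j' _; rewrite mxE mulr_suml mulr_sumr; apply: eq_bigr => i' _.
by rewrite mLe mxE mLe -mulrA; congr (_ * _); rewrite mulrCA mulrA.
Qed.

Lemma tmulRE (T U : 'M[K]_d) : tmul A T U =
  \sum_i \sum_j U i j *: ((mulR (E i))^T *m T *m mulR (E j)).
Proof.
have mRe i j b : mulR (E j) i b = mulc A i j 0 b.
  rewrite mxE (bigD1 j) //= mxE !eqxx mul1r big1 ?addr0 // => k ki.
  by rewrite mxE (negPf ki) andbF mul0r.
apply/matrixP=> a b; rewrite mxE summxE.
under eq_bigr do rewrite exchange_big /=.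
rewrite exchange_big /=; apply: eq_bigr => i' _.
under eq_bigr do rewrite exchange_big /=.
rewrite exchange_big /= summxE; apply: eq_bigr => j' _.
rewrite exchange_big !mxE mulr_sumr; apply: eq_bigr => j _.
rewrite mxE mulr_suml mulr_sumr; apply: eq_bigr => i _.
by rewrite mRe mxE mRe [T i j * _]mulrC -!mulrA [T i j * _]mulrCA.
Qed.
End StructureConstants.

(** * Hopf algebra axioms in Sweedler form *)

Section HopfAxioms.
Variables (K : fieldType) (d : nat) (A : hopf_data K d).
Hypothesis HA : is_hopf A.
Local Notation E i := (basis_vec K i).
Local Notation L := (mulL A).
Local Notation S := (antic A).
Local Notation mul := (hmul A).
Local Notation "p ** q" := (conv A p q) (at level 40, left associativity).

Lemma hmulA a b c : mul (mul a b) c = mul a (mul b c).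
Proof. by case: HA. Qed.
Lemma hmul1l a : mul (hone A) a = a.
Proof. by case: HA => _ [/(_ a) []]. Qed.
Lemma hmul1r a : mul a (hone A) = a.
Proof. by case: HA => _ [/(_ a) []]. Qed.
Lemma comul_mul a b : comul A (mul a b) = tmul A (comul A a) (comul A b).
Proof. by case: HA => _ [_ [_ [_ [[]]]]]. Qed.
Lemma comul_one : comul A (hone A) = (hone A)^T *m hone A.
Proof. by case: HA => _ [_ [_ [_ [[]]]]]. Qed.
Lemma counit_mul a b : counit A (mul a b) = counit A a * counit A b.
Proof. by case: HA => _ [_ [_ [_ [_ [[]]]]]]. Qed.
Lemma counit_one : counit A (hone A) = 1.
Proof. by case: HA => _ [_ [_ [_ [_ [[]]]]]]. Qed.

Lemma mulL_mul a b : L (mul a b) = L b *m L a.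
Proof.
by apply/row_matrixP=> i; rewrite !rowE mulmxA -!mulLE hmulA.
Qed.
Lemma mulR_mul a b : mulR A (mul a b) = mulR A a *m mulR A b.
Proof.
by apply/row_matrixP=> i; rewrite !rowE mulmxA -!mulRE hmulA.
Qed.
Lemma mulL1 : L (hone A) = 1%:M.
Proof. by apply/row_matrixP=> i; rewrite !rowE -mulLE hmul1l mulmx1. Qed.
Lemma mulR1 : mulR A (hone A) = 1%:M.
Proof. by apply/row_matrixP=> i; rewrite !rowE -mulRE hmul1r mulmx1. Qed.

Lemma hmulZl x a c : mul (x *: a) c = x *: mul a c.
Proof. by rewrite !mulLE linearZ -scalemxAr. Qed.
Lemma hmulZr x a c : mul c (x *: a) = x *: mul c a.
Proof. by rewrite !(mulLE A c) -scalemxAl. Qed.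
Lemma hmul_suml I r (P : pred I) (F : I -> 'rV[K]_d) c :
  mul (\sum_(i <- r | P i) F i) c = \sum_(i <- r | P i) mul (F i) c.
Proof. by rewrite mulLE linear_sum mulmx_sumr; apply: eq_bigr => i _; rewrite mulLE. Qed.
Lemma hmul_sumr I r (P : pred I) (F : I -> 'rV[K]_d) c :
  mul c (\sum_(i <- r | P i) F i) = \sum_(i <- r | P i) mul c (F i).
Proof. by rewrite mulRE linear_sum mulmx_sumr; apply: eq_bigr => i _; rewrite mulRE. Qed.

Section Sums.
Variable M : lmodType K.

(** Coassociativity seen through an arbitrary trilinear map, given by its values [g] on basis
    vectors; a Sweedler computation in h_1, h_2, h_3 amounts to a choice of [g]. *)
Lemma sum_coassoc (g : 'I_d -> 'I_d -> 'I_d -> M) h :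
  \sum_i \sum_j comul A h i j *: (\sum_k \sum_l comulc A i k l *: g k l j) =
  \sum_i \sum_j comul A h i j *: (\sum_k \sum_l comulc A j k l *: g i k l).
Proof.
have coassoc a b c : \sum_i comul A h i c * comulc A i a b =
    \sum_j comul A h a j * comulc A j b c by case: HA => _ [_ []].
transitivity (\sum_j \sum_k \sum_l
    (\sum_i comul A h i j * comulc A i k l) *: g k l j).
  rewrite exchange_big /=; apply: eq_bigr => j _.
  under eq_bigr do rewrite scaler_sumr.
  rewrite exchange_big /=; apply: eq_bigr => k _.
  under eq_bigr do rewrite scaler_sumr.
  rewrite exchange_big /=; apply: eq_bigr => l _.
  by rewrite scaler_suml; apply: eq_bigr => i _; rewrite scalerA.
transitivity (\sum_i \sum_k \sum_l
    (\sum_j comul A h i j * comulc A j k l) *: g i k l); last first.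
  apply: eq_bigr => j _.
  under [RHS]eq_bigr do rewrite scaler_sumr.
  rewrite [RHS]exchange_big /=; apply: eq_bigr => k _.
  under [RHS]eq_bigr do rewrite scaler_sumr.
  rewrite [RHS]exchange_big /=; apply: eq_bigr => l _.
  by rewrite scaler_suml; apply: eq_bigr => i _; rewrite scalerA.
rewrite exchange_big /=; apply: eq_bigr => k _.
rewrite exchange_big /=; apply: eq_bigr => l _.
by apply: eq_bigr => j _; rewrite coassoc.
Qed.

Lemma sum_counitr (g : 'I_d -> M) h :
  \sum_i \sum_j comul A h i j *: (counitc A 0 j *: g i) = \sum_i h 0 i *: g i.
Proof.
apply: eq_bigr => i _; case: HA => _ [_ [_ [/(_ h i) [_ <-]] _]].
by rewrite scaler_suml; apply: eq_bigr => j _; rewrite scalerA.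
Qed.

Lemma sum_counitl (g : 'I_d -> M) h :
  \sum_i \sum_j comul A h i j *: (counitc A 0 i *: g j) = \sum_i h 0 i *: g i.
Proof.
rewrite exchange_big /=.
apply: eq_bigr => i _; case: HA => _ [_ [_ [/(_ h i) [<- _]] _]].
by rewrite scaler_suml; apply: eq_bigr => j _; rewrite scalerA mulrC.
Qed.
End Sums.

Lemma sum_antipodel h :
  \sum_i \sum_j comul A h i j *: mul (E i *m S) (E j) = counit A h *: hone A.
Proof.
case: HA => _ [_ [_ [_ [_ [_ /(_ h) [<- _]]]]]]; rewrite /tmult /S_id.
transitivity (\sum_i \sum_j \sum_k (comul A h i j * S i k) *: mul (E k) (E j)).
  apply: eq_bigr => i _; apply: eq_bigr => j _.
  rewrite [E i *m S]row_sum_basis hmul_suml scaler_sumr; apply: eq_bigr => k _.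
  by rewrite hmulZl scalerA basis_mulmx mxE.
under eq_bigr do rewrite exchange_big /=.
rewrite exchange_big /=; apply: eq_bigr => k _.
rewrite exchange_big /=; apply: eq_bigr => j _.
by rewrite mxE scaler_suml; apply: eq_bigr => i _; rewrite mxE mulrC.
Qed.

Lemma sum_antipoder h :
  \sum_i \sum_j comul A h i j *: mul (E i) (E j *m S) = counit A h *: hone A.
Proof.
case: HA => _ [_ [_ [_ [_ [_ /(_ h) [_ <-]]]]]]; rewrite /tmult /id_S.
apply: eq_bigr => i _.
transitivity (\sum_j \sum_k (comul A h i j * S j k) *: mul (E i) (E k)).
  apply: eq_bigr => j _.
  rewrite [E j *m S]row_sum_basis hmul_sumr scaler_sumr; apply: eq_bigr => k _.
  by rewrite mulRE linearZ -scalemxAr -mulRE scalerA basis_mulmx mxE.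
rewrite exchange_big /=; apply: eq_bigr => k _.
by rewrite mxE scaler_suml; apply: eq_bigr => i' _.
Qed.

Lemma antipode_one : hone A *m S = hone A.
Proof.
have := sum_antipodel (hone A); rewrite counit_one scale1r comul_one => one.
rewrite -[LHS]hmul1r -[RHS]one exchange_big /=.
suff key x y : mul (x *m S) y =
  \sum_j \sum_i (x^T *m y) i j *: mul (E i *m S) (E j) by apply: key.
rewrite [in LHS](row_sum_basis y) hmul_sumr; apply: eq_bigr => j _.
rewrite [in LHS](row_sum_basis x) mulmx_suml hmul_suml.
apply: eq_bigr => i _; rewrite -scalemxAl hmulZl mulRE linearZ -scalemxAr -mulRE.
by rewrite scalerA [in RHS]mxE big_ord1 mxE.
Qed.

Lemma convA p q r : (p ** q) ** r = p ** (q ** r).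
Proof.
apply/rowP=> k; rewrite -[LHS]pair_basis -[RHS]pair_basis.
transitivity (\sum_i \sum_j comul A (E k) i j *:
   (\sum_a \sum_b comulc A i a b *: (p 0 a * q 0 b * r 0 j : K^o))).
  rewrite pair_conv mxE exchange_big /=; apply: eq_bigr => j _.
  rewrite mxE mulr_suml; apply: eq_bigr => i _.
  rewrite !mxE mulrAC mulrC mulr_suml; congr (_ * _).
  apply: eq_bigr => a _; rewrite mulr_suml.
  by apply: eq_bigr => b _; rewrite -!mulrA.
rewrite sum_coassoc pair_conv mxE; rewrite exchange_big /=.
apply: eq_bigr => j _; rewrite !mxE mulr_suml; apply: eq_bigr => i _.
rewrite [p 0 i * _]mulrC -mulrA; congr (_ * _).
rewrite mulr_sumr; apply: eq_bigr => a _.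
rewrite mulr_sumr; apply: eq_bigr => b _.
by rewrite /GRing.scale /= -!mulrA mulrCA.
Qed.


Lemma conv1r p : p ** counitc A = p.
Proof.
apply/rowP=> k; rewrite -pair_basis pair_conv mxE.
rewrite -(pair_basis p) /pair.
rewrite -[RHS](eq_bigr _ (fun i _ => mulrC _ _)).
rewrite -(sum_counitr (fun i => p 0 i : K^o)) exchange_big /=.
apply: eq_bigr => j _; rewrite mxE mulr_suml; apply: eq_bigr => i _.
by rewrite mxE /GRing.scale /= -!mulrA mulrCA; congr (_ * _); rewrite mulrC.
Qed.

Lemma convL_conv p q : convL A (p ** q) = convL A q *m convL A p.
Proof. by apply/row_matrixP=> i; rewrite !rowE mulmxA -!convLE convA. Qed.

Lemma convL_inj : injective (convL A).
Proof. by move=> p q pq; rewrite -[p]conv1r -[q]conv1r !convLE pq. Qed.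

Lemma convDl p q r : (p + q) ** r = p ** r + q ** r.
Proof. by rewrite !convLE linearD mulmxDr. Qed.
Lemma convDr p q r : r ** (p + q) = r ** p + r ** q.
Proof. by rewrite !convLE mulmxDl. Qed.
Lemma convZl x p q : (x *: p) ** q = x *: (p ** q).
Proof. by rewrite !convLE linearZ -scalemxAr. Qed.
Lemma convZr x p q : q ** (x *: p) = x *: (q ** p).
Proof. by rewrite !convLE -scalemxAl. Qed.
Lemma conv0l p : 0 ** p = 0.
Proof. by rewrite convLE linear0 mulmx0. Qed.
Lemma conv0r p : p ** 0 = 0.
Proof. by rewrite convLE mul0mx. Qed.
Lemma convBl p q r : (p - q) ** r = p ** r - q ** r.
Proof. by rewrite !convLE linearB mulmxBr. Qed.
Lemma convBr p q r : r ** (p - q) = r ** p - r ** q.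
Proof. by rewrite !convLE mulmxBl. Qed.
Lemma conv_suml I r (P : pred I) (F : I -> 'rV[K]_d) q :
  (\sum_(i <- r | P i) F i) ** q = \sum_(i <- r | P i) (F i ** q).
Proof. by rewrite convLE linear_sum mulmx_sumr; apply: eq_bigr => i _; rewrite convLE. Qed.
Lemma conv_sumr I r (P : pred I) (F : I -> 'rV[K]_d) q :
  q ** (\sum_(i <- r | P i) F i) = \sum_(i <- r | P i) (q ** F i).
Proof. by rewrite convLE mulmx_suml; apply: eq_bigr => i _; rewrite convLE. Qed.
End HopfAxioms.

(** * Integrals and the antipode *)

Section Integrals.
#[local] Opaque comul hmul conv harp.
Variables (K : fieldType) (d : nat) (A : hopf_data K d).
Hypothesis HA : is_hopf A.
Local Notation E i := (basis_vec K i).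
Local Notation L := (mulL A).
Local Notation S := (antic A).
Local Notation mul := (hmul A).
Local Notation "p ** q" := (conv A p q) (at level 40, left associativity).
Variables Lam lam : 'rV[K]_d.
Hypotheses (HLam : integral_H A Lam) (Hlam : integral_Hstar A lam).
Hypothesis lam_Lam : pair lam Lam = 1.
Local Notation D := (comul A Lam).

(* [Lam_1 (x) h Lam_2 = S h Lam_1 (x) Lam_2] *)
Lemma comulL_integral h : D *m L h = (L (h *m S))^T *m D.
Proof.
have expand x : counit A x *: D =
    \sum_k \sum_l comul A x k l *: ((L (E k))^T *m D *m L (E l)).
  by rewrite -tmulE -comul_mul // (HLam x).1 linearZ.
(* S h_1 h_2 Lam_1 (x) h_3 Lam_2 is evaluated in two ways: h_2 and h_3 are absorbed by Delta (h Lam)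
   = counit h Delta Lam, or S h_1 h_2 collapses by the antipode axiom. *)
have := sum_coassoc HA (fun k l j =>
   (L (E k *m S))^T *m ((L (E l))^T *m D *m L (E j))) h.
under [RHS]eq_bigr => i _ do under eq_bigr => j _ do
  (under eq_bigr => k _ do (under eq_bigr => l _ do rewrite scalemxAr;
   rewrite -mulmx_sumr); rewrite -mulmx_sumr -(comul_basis A) -expand counitE
   pair_basis -scalemxAr).
rewrite (sum_counitr HA (fun i => (L (E i *m S))^T *m D)) => eq2.
transitivity (\sum_i h 0 i *: ((L (E i *m S))^T *m D)); last first.
  by rewrite [RHS](linear_basis (mulmxr D \o trmx \o L \o mulmxr S)).
rewrite -eq2.
transitivity (\sum_i \sum_j comul A h i j *: (counitc A 0 i *: (D *m L (E j)))).
  by rewrite sum_counitl // [LHS](linear_basis (mulmx D \o L)).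
apply: eq_bigr => i _; apply: eq_bigr => j _; congr (_ *: _).
transitivity ((L (\sum_k \sum_l comul A (E i) k l *: mul (E k *m S) (E l)))^T
  *m D *m L (E j)).
  rewrite sum_antipodel // counitE pair_basis !linearZ /= mulL1 // trmx1.
  by rewrite -!scalemxAl mul1mx.
rewrite (linear_sum L) (linear_sum trmx) !mulmx_suml; apply: eq_bigr => k _.
rewrite (linear_sum L) (linear_sum trmx) !mulmx_suml; apply: eq_bigr => l _.
by rewrite !linearZ /= mulL_mul // trmx_mul comul_basis -!scalemxAl !mulmxA.
Qed.

(* [Lam_1 h (x) Lam_2 = Lam_1 (x) Lam_2 S h] *)
Lemma comulR_integral h : (mulR A h)^T *m D = D *m mulR A (h *m S).
Proof.
have expand x : counit A x *: D =
    \sum_k \sum_l comul A x k l *: ((mulR A (E k))^T *m D *m mulR A (E l)).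
  by rewrite -tmulRE -comul_mul // (HLam x).2 linearZ.
(* The mirror computation, with Lam_1 h_1 (x) Lam_2 h_2 S h_3. *)
have := sum_coassoc HA (fun k l j =>
   ((mulR A (E k))^T *m D *m mulR A (E l)) *m mulR A (E j *m S)) h.
under eq_bigr => i _ do under eq_bigr => j _ do
  (under eq_bigr => k _ do (under eq_bigr => l _ do rewrite scalemxAl;
   rewrite -mulmx_suml); rewrite -mulmx_suml -(comul_basis A) -expand counitE
   pair_basis -scalemxAl).
rewrite (sum_counitl HA (fun i => D *m mulR A (E i *m S))) => eq2.
transitivity (\sum_i h 0 i *: (D *m mulR A (E i *m S))); last first.
  by rewrite [RHS](linear_basis (mulmx D \o mulR A \o mulmxr S)).
rewrite eq2.
transitivity (\sum_i \sum_j comul A h i j *: (counitc A 0 j *: ((mulR A (E i))^T *m D))).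
  by rewrite sum_counitr // [LHS](linear_basis (mulmxr D \o trmx \o mulR A)).
apply: eq_bigr => i _; apply: eq_bigr => j _; congr (_ *: _).
transitivity ((mulR A (E i))^T *m D *m
  mulR A (\sum_k \sum_l comul A (E j) k l *: mul (E k) (E l *m S))).
  rewrite sum_antipoder // counitE pair_basis !linearZ /= mulR1 //.
  by rewrite -?scalemxAr mulmx1.
rewrite (linear_sum (mulR A)) mulmx_sumr; apply: eq_bigr => k _.
rewrite (linear_sum (mulR A)) mulmx_sumr; apply: eq_bigr => l _.
by rewrite !linearZ /= mulR_mul // comul_basis -?scalemxAr !mulmxA.
Qed.

Definition gram : 'M[K]_d := \matrix_(i, j) pair lam (mul (E i) (E j)).
Local Notation G := gram.

Lemma gramE x y : pair lam (mul x y) = (x *m G *m y^T) 0 0.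
Proof.
rewrite [in LHS](row_sum_basis y) hmul_sumr pair_sumr mxE.
apply: eq_bigr => j _; rewrite [in LHS](row_sum_basis x) hmul_suml pair_sumr.
rewrite !mxE mulr_suml; apply: eq_bigr => i _.
by rewrite hmulZl pairZr mulRE linearZ -scalemxAr -mulRE pairZr mxE mulrA mulrAC.
Qed.

(** For every [p], the number p (Lam_1) lam (Lam_2) is the value of [p ** lam] at [Lam], that is, p
    (1). *)
Lemma integral_legr : D *m lam^T = (hone A)^T.
Proof.
apply/row_matrixP=> i; apply/rowP=> j; rewrite (ord1 j) -basis_mulmx mulmxA.
by rewrite -pair_conv (Hlam (E i)).1 pairZl lam_Lam mulr1 pairE rowE.
Qed.

Lemma integral_legl : lam *m D = hone A.
Proof.
apply: trmx_inj; apply/row_matrixP=> i; apply/rowP=> j; rewrite (ord1 j).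
rewrite -basis_mulmx -[E i]trmxK -trmx_mul mxE.
by rewrite -pair_conv (Hlam (E i)).2 pairZl lam_Lam mulr1 pairE rowE.
Qed.

Let gram_row h : (h *m G)^T = L h *m lam^T.
Proof.
apply/row_matrixP=> i; apply/rowP=> j; rewrite (ord1 j) -!basis_mulmx mulmxA.
rewrite -mulLE -[E i *m _]trmxK [in LHS]trmx_mul trmxK mxE -[LHS]gramE.
by rewrite pairC pairE.
Qed.

Let gram_col h : (h *m G^T)^T = mulR A h *m lam^T.
Proof.
apply/row_matrixP=> i; apply/rowP=> j; rewrite (ord1 j) -!basis_mulmx mulmxA.
by rewrite -mulRE trmx_mul trmxK mulmxA -[LHS]gramE pairC pairE.
Qed.

(* The next four lemmas apply [lam] to one leg of the two identities above. *)
Lemma antipode_gram1 : G *m D^T = S.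
Proof.
apply/row_matrixP=> i; rewrite !rowE; set h := delta_mx _ _.
apply: trmx_inj; rewrite mulmxA trmx_mul trmxK gram_row mulmxA comulL_integral.
by rewrite -mulmxA integral_legr -trmx_mul -mulLE hmul1r.
Qed.

Lemma antipode_gram2 : S *m G *m D = 1%:M.
Proof.
apply/row_matrixP=> i; rewrite !rowE; set h := delta_mx _ _.
rewrite mulmx1 !mulmxA -[_ *m G]trmxK gram_row trmx_mul trmxK -mulmxA.
by rewrite -comulL_integral mulmxA integral_legl -mulLE hmul1r.
Qed.

Lemma antipode_gram3 : G^T *m D = S.
Proof.
apply/row_matrixP=> i; rewrite !rowE; set h := delta_mx _ _.
rewrite mulmxA -[_ *m G^T]trmxK gram_col trmx_mul trmxK -mulmxA.
by rewrite comulR_integral mulmxA integral_legl -mulRE hmul1l.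
Qed.

Lemma antipode_gram4 : S *m G^T *m D^T = 1%:M.
Proof.
apply/row_matrixP=> i; rewrite !rowE; set h := delta_mx _ _.
apply: trmx_inj; rewrite mulmx1 !mulmxA trmx_mul trmxK gram_col mulmxA.
by rewrite -comulR_integral -mulmxA integral_legr -trmx_mul -mulRE hmul1l.
Qed.

Lemma antipode_unit : S \in unitmx.
Proof. by have := antipode_gram2; rewrite -mulmxA => /mulmx1_unit []. Qed.

Lemma comul_integral_unit : D \in unitmx.
Proof. by have /mulmx1_unit [] := antipode_gram2. Qed.

Lemma gram_unit : G \in unitmx.
Proof.
by have /mulmx1_unit [] := antipode_gram2; rewrite unitmx_mul => /andP[].
Qed.

(** [antipode_gram2] makes [G] the inverse of [D *m S]; substitute this in [antipode_gram1]. So S ^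
    2 measures the failure of [Lam] to be cocommutative. *)
Lemma comul_integral_tr : D^T = D *m S *m S.
Proof.
have G_eq : G = invmx S *m invmx D.
  have := antipode_gram2; rewrite -mulmxA => /(canRL (mulKmx antipode_unit)).
  by rewrite mulmx1 => /(canRL (mulmxK comul_integral_unit)).
have e1 := antipode_gram1; rewrite G_eq -mulmxA in e1.
rewrite -mulmxA -{2}e1 mulKVmx ?antipode_unit //.
by rewrite mulKVmx ?comul_integral_unit.
Qed.

Lemma gram_tr : G^T = S *m S *m G.
Proof.
have GT : G^T = S *m invmx D.
  by rewrite -antipode_gram3 mulmxK // comul_integral_unit.
rewrite GT; apply: (canLR (mulmxK comul_integral_unit)).
by rewrite -!mulmxA (mulmxA _ G) antipode_gram2 mulmx1.
Qed.

(** Substituting the two transposes in [antipode_gram4] leaves [S *m G *m D], which is 1, between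
    two copies of S ^ 2. This is Radford's formula with trivial distinguished group-likes, both
    integrals being two-sided. *)
Lemma antipode4 : S *m S *m (S *m S) = 1%:M.
Proof.
rewrite -antipode_gram4 gram_tr comul_integral_tr -{1}(mulmx1 (S *m S)).
by rewrite -[in LHS]antipode_gram2 !mulmxA.
Qed.

(** Writing one [S] as [G *m D^T] turns the trace into lam (h S Lam_1 Lam_2), to which the antipode
    axiom applies. *)
Lemma antipode_trace h : \tr (S *m S *m L h) = counit A Lam * pair lam h.
Proof.
rewrite -mulmxA mxtrace_mulC -{2}antipode_gram1 !mulmxA /mxtrace.
transitivity (\sum_i \sum_j D i j * pair lam (mul h (mul (E i *m S) (E j)))).
  apply: eq_bigr => i _; rewrite mxE; apply: eq_bigr => j _.
  rewrite [D^T _ _]mxE mulrC; congr (_ * _).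
  by rewrite -hmulA // gramE (mulLE A h) entry_basis !mulmxA.
transitivity (pair lam (mul h (\sum_i \sum_j D i j *: mul (E i *m S) (E j)))).
  rewrite hmul_sumr pair_sumr; apply: eq_bigr => i _.
  rewrite hmul_sumr pair_sumr; apply: eq_bigr => j _.
  by rewrite hmulZr pairZr.
by rewrite sum_antipodel // hmulZr pairZr hmul1r.
Qed.

Lemma conv_antipode_trace p :
  \tr (S^T *m S^T *m convL A p) = pair lam (hone A) * pair p Lam.
Proof.
rewrite -mulmxA mxtrace_mulC.
have -> : S^T *m convL A p *m S^T = S^T *m convL A p *m D *m G^T.
  by rewrite -!mulmxA -[D *m G^T]trmxK trmx_mul trmxK antipode_gram1.
(* The trace becomes p (Lam_1) lam (S Lam_2 Lam_3), whose last two legs collapse by the antipode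
   axiom. *)
transitivity (\sum_i \sum_j D i j *: (\sum_k \sum_l comulc A i k l *:
   (p 0 k * pair lam (mul (E l *m S) (E j)) : K^o))); last first.
  rewrite sum_coassoc //.
  transitivity (\sum_i \sum_j D i j *:
     (counitc A 0 j *: (p 0 i * pair lam (hone A) : K^o))).
    apply: eq_bigr => i _; apply: eq_bigr => j _; apply: (congr1 ( *%R (D i j))).
    have := sum_antipodel HA (E j); rewrite counitE pair_basis comul_basis => e.
    have := congr1 (fun x => p 0 i * pair lam x) e.
    rewrite pairZr mulrCA => e2; refine (etrans _ e2); rewrite pair_sumr mulr_sumr.
    apply: eq_bigr => k _; rewrite pair_sumr mulr_sumr.
    by apply: eq_bigr => l _; rewrite pairZr mulrCA.
  rewrite sum_counitr //; move: (pair lam (hone A)) => c.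
  rewrite [RHS]mulrC (pairC p) mulr_suml; apply: eq_bigr => i _.
  by rewrite /GRing.scale /= mulrA.
rewrite -!mulmxA mxtrace_mulC -!mulmxA -trmx_mul mulmxA /mxtrace.
have eSG l j : pair lam (mul (E l *m S) (E j)) = (S *m G) l j.
  by rewrite gramE [RHS]entry_basis !mulmxA.
transitivity (\sum_l \sum_j \sum_i \sum_k
    D i j * (comulc A i k l * (p 0 k * (S *m G) l j))).
  apply: eq_bigr => l _; rewrite mxE; apply: eq_bigr => j _.
  move: (S *m G) => SG; rewrite !(mxE mulmx_key) [SG^T _ _]mxE mulr_suml; apply: eq_bigr => i _.
  rewrite [convL _ _ _ _]mxE !mulr_suml; apply: eq_bigr => k _.
  by rewrite -!mulrA [RHS]mulrCA; congr (_ * _); rewrite mulrCA.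
under eq_bigr => l _ do rewrite exchange_big.
rewrite exchange_big; apply: eq_bigr => i _ /=.
rewrite exchange_big; apply: eq_bigr => j _ /=.
rewrite exchange_big scaler_sumr; apply: eq_bigr => k _ /=.
by rewrite scaler_sumr; apply: eq_bigr => l _; rewrite eSG.
Qed.
End Integrals.

(** * Matrices *)

Section Matrices.

(** A full rank factorisation P = C R of an idempotent satisfies R C = 1, an identity matrix of size
    rank P. *)
Lemma mxtrace_idem (F : fieldType) n (P : 'M[F]_n) :
  P *m P = P -> \tr P = (\rank P)%:R.
Proof.
move=> PP.
have := mulmx_base P; move: (col_base P) (row_base P) (col_base_full P)
  (row_base_free P) => C R /row_full_inj Cinj /row_free_inj Rinj CR.
rewrite -{1}CR mxtrace_mulC.
suff -> : R *m C = 1%:M by rewrite mxtrace1.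
apply: Cinj; rewrite mulmx1; apply: Rinj => /=.
by rewrite !mulmxA CR -mulmxA CR PP.
Qed.

(** [Q] splits the image of [P] into eigenspaces for 1 and -1, of dimensions [a] and [b], with
    projections (P + P Q) / 2 and (P - P Q) / 2. *)
Lemma mxtrace_involution (F : numFieldType) n (P Q : 'M[F]_n) :
  P *m P = P -> Q *m Q = 1%:M -> P *m Q = Q *m P ->
  exists a b : nat, [/\ \tr (P *m Q) = a%:R - b%:R, \tr P = a%:R + b%:R,
     a = 0%N -> P *m Q = - P & b = 0%N -> P *m Q = P].
Proof.
move=> PP QQ PQ.
have n2 : (2%:R : F) != 0 by rewrite pnatr_eq0.
have half (x : F) : 2%:R^-1 * (x + x) = x.
  by rewrite -mulr2n -[x *+ 2]mulr_natl mulKf.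
have PQPQ : P *m Q *m (P *m Q) = P.
  by rewrite mulmxA -(mulmxA P) -PQ mulmxA PP -mulmxA QQ mulmx1.
have PPQ : P *m (P *m Q) = P *m Q by rewrite mulmxA PP.
have PQP : P *m Q *m P = P *m Q by rewrite -mulmxA -PQ mulmxA PP.
have idem (e : F) : e * e = 1 ->
    let M := 2%:R^-1 *: (P + e *: (P *m Q)) in M *m M = M.
  move=> ee /=; rewrite -scalemxAl -scalemxAr scalerA.
  rewrite mulmxDl !mulmxDr -!scalemxAl -!scalemxAr PP PQPQ PPQ PQP scalerA ee.
  rewrite scale1r [e *: _ + P]addrC -mulr2n -scaler_nat scalerA.
  by congr (_ *: _); rewrite -mulrA mulVf ?mulr1.
have eN : (-1 : F) * -1 = 1 by rewrite mulrNN mulr1.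
exists (\rank (2%:R^-1 *: (P + 1 *: (P *m Q)))).
exists (\rank (2%:R^-1 *: (P + -1 *: (P *m Q)))).
have iV : (2%:R^-1 : F) != 0 by rewrite invr_eq0.
split.
- rewrite -!mxtrace_idem ?idem ?mulr1 // !mxtraceZ !mxtraceD !mxtraceZ.
  rewrite -mulrBr opprD addrACA subrr add0r mulN1r opprK mul1r.
  by rewrite half.
- rewrite -!mxtrace_idem ?idem ?mulr1 // !mxtraceZ !mxtraceD !mxtraceZ.
  by rewrite -mulrDr mulN1r mul1r addrACA subrr addr0 half.
- move/eqP; rewrite mxrank_eq0 scaler_eq0 (negPf iV) scale1r addrC.
  by rewrite addr_eq0 => /eqP.
- move/eqP; rewrite mxrank_eq0 scaler_eq0 (negPf iV) scaleN1r subr_eq0.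
  by move=> /eqP.
Qed.

(** Powers are written with [iter] so that [n] may be any size; [iter_mulmxX] returns to ring powers
    at size [n.+1]. *)
Definition nilpotentmx (F : fieldType) n (Y : 'M[F]_n) :=
  exists k, iter k (mulmx Y) 1%:M = 0.

Lemma iter_mulmxX (F : fieldType) n (Y : 'M[F]_n.+1) k :
  iter k (mulmx Y) 1%:M = Y ^+ k.
Proof. by elim: k => //= k ->; rewrite exprS. Qed.

Lemma eigenvalues0_char_poly (F : closedFieldType) n (Y : 'M[F]_n) :
  (forall a, eigenvalue Y a -> a = 0) -> char_poly Y = 'X^n.
Proof.
move=> ev0; have [r def] := closed_field_poly_normal (char_poly Y).
rewrite (monicP (char_poly_monic Y)) scale1r in def.
have r0 z : z \in r -> z = 0.
  move=> zr; apply: ev0; rewrite eigenvalue_root_char def.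
  by rewrite root_prod_XsubC.
have := size_char_poly Y; rewrite def size_prod_XsubC => -[<-].
elim: r r0 {def} => [|z r IH] r0; first by rewrite big_nil expr0.
rewrite big_cons (r0 z) ?mem_head // subr0 IH ?exprS // => x xr.
by apply: r0; rewrite in_cons xr orbT.
Qed.

Lemma mxtrace_nilpotent (F : closedFieldType) n (Y : 'M[F]_n) :
  nilpotentmx Y -> \tr Y = 0.
Proof.
case: n Y => [|n] Y [k Yk]; first by rewrite /mxtrace big_ord0.
apply: oppr_inj; rewrite oppr0 -char_poly_trace // eigenvalues0_char_poly.
  by rewrite coefXn ltn_eqF.
move=> a /eigenvalueP [v vY v0].
have vYk j : v *m Y ^+ j = a ^+ j *: v.
  elim: j => [|j IH]; first by rewrite mulmx1 scale1r.
  by rewrite exprS mulmxA vY -scalemxAl IH scalerA -exprS.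
have := vYk k; rewrite -iter_mulmxX Yk mulmx0 => /esym/eqP.
by rewrite scaler_eq0 (negPf v0) orbF expf_eq0 => /andP[_ /eqP].
Qed.

(* Fitting's lemma: the spectral projection of [X] at a nonzero eigenvalue is a
   polynomial in [X] without constant term, hence lies in [Q]. *)
Lemma corner_local (F : closedFieldType) n (Q : 'M[F]_n -> Prop) (P X : 'M[F]_n) :
  (forall a B C, Q B -> Q C -> Q (a *: B + C)) ->
  (forall B C, Q B -> Q C -> Q (B *m C)) ->
  (forall B, Q B -> P *m B = B /\ B *m P = B) ->
  (forall B, Q B -> B *m B = B -> B = 0 \/ B = P) ->
  Q X -> exists a, nilpotentmx (X - a *: P).
Proof.
case: n Q P X => [|n] Q P X Qlin Qmul Qcorner Qidem QX.
  by exists 0, 0%N; apply/matrixP=> -[].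
(* Without a nonzero eigenvalue, [X] is itself nilpotent by Cayley-Hamilton, and the scalar 0 will
   do. *)
have [[a [a0 evX]]|no_ev] :=
    pselect (exists a, a != 0 /\ eigenvalue X a); last first.
  exists 0, n.+1; rewrite scale0r subr0 iter_mulmxX -[X in X ^+ _]horner_mx_X.
  rewrite -rmorphXn /= -(@eigenvalues0_char_poly F n.+1 X) ?Cayley_Hamilton //.
  by move=> a ev; apply: contrapT => /eqP a0; apply: no_ev; exists a.
have [PX XP] := Qcorner X QX.
have Qpoly q : Q (horner_mx X ('X * q)).
  elim/poly_ind: q => [|q c IH].
    by rewrite mulr0 rmorph0 -(addNr X) -scaleN1r; apply: Qlin.
  rewrite mulrDr mulrA rmorphD /= [horner_mx _ (_ * 'X)]rmorphM /= horner_mx_X.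
  rewrite [X in _ + X]rmorphM /= horner_mx_X horner_mx_C -scalemx1 -mulmxE.
  rewrite -scalemxAr mulmx1 addrC; apply: Qlin => //; exact: Qmul.
have [k [g0 /implyP]] := multiplicity_XsubC (char_poly X) a.
rewrite -size_poly_gt0 size_char_poly => /(_ isT) g0a def_c.
set h := ('X - a%:P) ^+ k in def_c.
have cop : coprimep ('X * g0) h.
  by apply: coprimep_expr; rewrite coprimep_XsubC rootM negb_or g0a {1}/root hornerX a0.
have /Bezout_eq1_coprimepP [[u v] /= uv] := cop.
have cX0 w : horner_mx X (w * char_poly X) = 0.
  by rewrite rmorphM /= Cayley_Hamilton mulr0.
(* This polynomial is 1 modulo [h] and 0 modulo [g0], so its value at [X] is the spectral projection
   at [a]. The factor 'X, coprime to [h] because [a != 0], keeps the value in [Q]. *)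
set E := horner_mx X ('X * (u * g0)).
have Euv : 'X * (u * g0) = 1 - v * h.
  by rewrite -uv addrK mulrCA.
have EE : E *m E = E.
  apply/eqP; rewrite -subr_eq0 mulmxE -rmorphM -rmorphB /=.
  rewrite {1}Euv mulrBl mul1r addrAC subrr sub0r.
  have -> : v * h * ('X * (u * g0)) = v * 'X * u * char_poly X.
    by rewrite def_c; ring.
  by rewrite rmorphN /= cX0 oppr0.
have EP : E = P.
  case: (Qidem E (Qpoly _) EE) => // E0; case/eigenvalueP: (evX) => w wX w0.
  (* On the eigenvector [w] the matrix [E] acts by the value of its polynomial at [a], which is 1;
     so [E] is not zero. *)
  have wq q : w *m horner_mx X q = q.[a] *: w.
    elim/poly_ind: q => [|q c IH]; first by rewrite rmorph0 mulmx0 horner0 scale0r.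
    rewrite rmorphD rmorphM /= horner_mx_X horner_mx_C mulmxDr -mulmxE mulmxA IH.
    by rewrite -scalemxAl wX scalerA mul_mx_scalar -scalerDl !hornerE.
  have [k0|k0] := posnP k.
    move: evX; rewrite eigenvalue_root_char def_c /h k0 expr0 mulr1.
    by rewrite (negPf g0a).
  have := wq ('X * (u * g0)); rewrite -/E E0 mulmx0 Euv.
  rewrite hornerD hornerN hornerM horner_exp hornerXsubC subrr expr0n eqn0Ngt k0.
  rewrite mulr0 subr0 hornerC scale1r => w00.
  by rewrite -w00 eqxx in w0.
have PP : P *m P = P by rewrite -EP.
(* One factor [Y] supplies a copy of [P], which is [E]; the other [k] factors then give [h] at [X],
   and [h] times the polynomial of [E] is a multiple of [char_poly X]. *)
exists a, k.+1; rewrite iter_mulmxX.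
set Y := X - a *: P.
have YP j : Y ^+ j *m P = horner_mx X (('X - a%:P) ^+ j) *m P.
  elim: j => [|j IH]; first by rewrite !expr0 rmorph1.
  set H := horner_mx X _ in IH.
  have HP : H *m P = P *m H by apply: comm_horner_mx; rewrite /comm_mx PX XP.
  rewrite exprS -mulmxE -mulmxA IH HP mulmxA exprS rmorphM rmorphB /= -mulmxE.
  rewrite horner_mx_X horner_mx_C -/H -[RHS]mulmxA HP [RHS]mulmxA; congr (_ *m _).
  by rewrite !mulmxBl -scalemxAl PP mul_scalar_mx.
have -> : Y ^+ k.+1 = Y ^+ k *m P *m Y.
  by rewrite exprSr -mulmxE -mulmxA [P *m Y]mulmxBr PX -scalemxAr PP.
rewrite YP -{1}EP -/h mulmxE -rmorphM /=.
have -> : h * ('X * (u * g0)) = 'X * u * char_poly X by rewrite def_c; ring.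
by rewrite cX0 mul0r.
Qed.
(** If [Y] is not zero, let [Yj] be its last nonzero power: W Y Yj = 0 gives Z Yj = - a Yj, and a
    nilpotent [Z] has no nonzero eigenvalue. *)
Lemma nilpotent_corner (F : fieldType) n (P Y W Z : 'M[F]_n) a :
  P *m Y = Y -> nilpotentmx Y -> nilpotentmx Z -> W *m Y = a *: P + Z ->
  a = 0 \/ Y = 0.
Proof.
move=> PY [k0 Yk0] [j Zj] WY.
have exk : exists k, iter k (mulmx Y) 1%:M == 0 by exists k0; apply/eqP.
case: (ex_minnP exk) => -[|k] /= /eqP Yk kmin.
  by right; rewrite -[Y]mulmx1 Yk mulmx0.
set Yj := iter k _ _ in Yk.
have Yj0 : Yj != 0 by apply: contraTN isT => /kmin; rewrite ltnn.
case: k @Yj Yk Yj0 {kmin} => [|k] Yj Yk Yj0.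
  by right; rewrite -[Y]mulmx1.
have PYj : P *m Yj = Yj by rewrite /Yj /= mulmxA PY.
have ZYj : Z *m Yj = (- a) *: Yj.
  have := congr1 (mulmx W) Yk; rewrite mulmx0 mulmxA WY mulmxDl -scalemxAl PYj.
  by move/eqP; rewrite addrC addr_eq0 scaleNr => /eqP.
have ZjYj i : iter i (mulmx Z) 1%:M *m Yj = (- a) ^+ i *: Yj.
  elim: i => [|i IH] /=; first by rewrite mul1mx scale1r.
  by rewrite -mulmxA IH -scalemxAr ZYj scalerA exprSr.
left; have := ZjYj j; rewrite Zj mul0mx => /esym/eqP.
by rewrite scaler_eq0 (negPf Yj0) orbF expf_eq0 oppr_eq0 => /andP[_ /eqP].
Qed.

(** The subspace is only a predicate, so a matrix of maximal rank with rows in [P] is chosen: it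
    spans [P], and the columns of its cokernel annihilate [P]. *)
Lemma subspace_full (F : fieldType) m (P : 'rV[F]_m -> Prop) :
  P 0 -> (forall a u v, P u -> P v -> P (a *: u + v)) ->
  (forall c : 'cV_m, (forall u, P u -> u *m c = 0) -> c = 0) -> forall u, P u.
Proof.
move=> P0 Plin Pann.
pose inP r := `[< exists M : 'M_m, \rank M = r /\ forall v, (v <= M)%MS -> P v >].
have ex0 : exists r, inP r.
  exists 0%N; apply/asboolP; exists 0; split=> [|v]; first exact: mxrank0.
  by rewrite submx0 => /eqP->.
have bnd r : inP r -> (r <= m)%N.
  by move=> /asboolP [M [<- _]]; apply: rank_leq_row.
case: (ex_maxnP ex0 bnd) => r /asboolP [M [rkM MP]] rmax.
have PM u : P u -> (u <= M)%MS.
  move=> Pu; apply: contraT => uM.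
  have : inP (\rank (M + u)%MS).
    apply/asboolP; exists (M + u)%MS; split=> // v /sub_addsmxP [[x y] ->] /=.
    rewrite addrC; have [y0 ->] : exists c, y = c%:M by exists (y 0 0); apply: mx11_scalar.
    by rewrite mul_scalar_mx; apply: Plin => //; apply/MP/submxMl.
  move/rmax; rewrite -rkM leqNgt => /negP[].
  by rewrite (ltn_leqif (mxrank_leqif_sup (addsmxSl M u))) addsmx_sub submx_refl.
have coker0 : cokermx M = 0.
  apply/trmx_inj/row_matrixP=> i; rewrite -tr_col trmx0 row0; apply: trmx_inj.
  rewrite trmx0 trmxK; apply: Pann => u /PM; rewrite submxE => /eqP uM.
  by rewrite colE mulmxA uM mul0mx.
by move=> u; apply: MP; rewrite submxE coker0 mulmx0.
Qed.
End Matrices.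

(** * Modules and characters *)

Section Tensor.
Variable K : fieldType.

Lemma mxtrace_tens m n (B : 'M[K]_m) (C : 'M[K]_n) :
  \tr (B *t C) = \tr B * \tr C.
Proof. by rewrite /mxtrace mulr_sum; apply: eq_bigr => i _; rewrite mxE. Qed.

Lemma tensmx1 m n : (1%:M : 'M[K]_m) *t (1%:M : 'M[K]_n) = 1%:M.
Proof.
apply/matrixP=> i j; case: (mxtens_indexP i) (mxtens_indexP j) => i0 i1 [j0 j1].
rewrite tensmxE !mxE (can_eq (@mxtens_indexK _ _)) xpair_eqE.
by case: eqP; rewrite ?mul1r ?mul0r.
Qed.

Lemma tensmxZl m n p q a (B : 'M[K]_(m, n)) (C : 'M[K]_(p, q)) :
  (a *: B) *t C = a *: (B *t C).
Proof. by apply/matrixP=> i j; rewrite !mxE mulrA. Qed.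

Lemma tensmxZr m n p q a (B : 'M[K]_(m, n)) (C : 'M[K]_(p, q)) :
  B *t (a *: C) = a *: (B *t C).
Proof. by apply/matrixP=> i j; rewrite !mxE mulrCA. Qed.

Lemma tensmx_suml m n p q I r (P : pred I) (F : I -> 'M[K]_(m, n)) (C : 'M[K]_(p, q)) :
  (\sum_(i <- r | P i) F i) *t C = \sum_(i <- r | P i) F i *t C.
Proof.
apply/matrixP=> i j; rewrite mxE !summxE mulr_suml.
by apply: eq_bigr => k _; rewrite mxE.
Qed.

Lemma tensmx_sumr m n p q I r (P : pred I) (F : I -> 'M[K]_(m, n)) (C : 'M[K]_(p, q)) :
  C *t (\sum_(i <- r | P i) F i) = \sum_(i <- r | P i) C *t F i.
Proof.
apply/matrixP=> i j; rewrite mxE !summxE mulr_sumr.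
by apply: eq_bigr => k _; rewrite mxE.
Qed.
End Tensor.

Section TensorModules.
Variables (K : fieldType) (d : nat) (A : hopf_data K d).
Hypothesis HA : is_hopf A.
Local Notation E i := (basis_vec K i).
Local Notation L := (mulL A).
Local Notation S := (antic A).
Local Notation mul := (hmul A).
Local Notation "p ** q" := (conv A p q) (at level 40, left associativity).
#[local] Opaque comul hmul conv harp.

Lemma rep_is_linear (V : hmodule K d) : linear (rep V).
Proof.
move=> a x y; rewrite /rep scaler_sumr -big_split; apply: eq_bigr => i _.
by rewrite !mxE scalerDl scalerA.
Qed.
HB.instance Definition _ (V : hmodule K d) :=
  GRing.isLinear.Build K 'rV[K]_d 'M[K]_(mdim V) _ (rep V) (rep_is_linear V).

Lemma rep_basis (V : hmodule K d) i : rep V (E i) = mact V i.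
Proof.
rewrite /rep (bigD1 i) //= mxE !eqxx scale1r big1 ?addr0 // => j ji.
by rewrite mxE (negPf ji) andbF scale0r.
Qed.

Lemma pair_character (V : hmodule K d) h : pair (character V) h = \tr (rep V h).
Proof.
rewrite linear_sum /pair; apply: eq_bigr => i _.
by rewrite mxE linearZ mulrC.
Qed.

Lemma character_tracelike (V : hmodule K d) x y : is_module A V ->
  pair (character V) (mul x y) = pair (character V) (mul y x).
Proof. by case=> repM _; rewrite !pair_character !repM mxtrace_mulC. Qed.

Lemma pair_character1 (V : hmodule K d) : is_module A V ->
  pair (character V) (hone A) = (mdim V)%:R.
Proof. by case=> _ rep1; rewrite pair_character rep1 mxtrace1. Qed.

Definition tens_map m n p q (f : 'rV[K]_d -> 'M[K]_(m, n))
    (g : 'rV[K]_d -> 'M[K]_(p, q)) (T : 'M[K]_d) : 'M[K]_(m * p, n * q) :=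
  \sum_i \sum_j T i j *: (f (E i) *t g (E j)).

Section TensMap.
Variables (m n p q : nat) (f : {linear 'rV[K]_d -> 'M[K]_(m, n)})
    (g : {linear 'rV[K]_d -> 'M[K]_(p, q)}).

Lemma tens_map_is_linear : linear (tens_map f g).
Proof.
move=> a T U; rewrite /tens_map scaler_sumr -big_split; apply: eq_bigr => i _.
rewrite scaler_sumr -big_split; apply: eq_bigr => j _ /=.
by rewrite !mxE scalerDl scalerA.
Qed.
HB.instance Definition _ := GRing.isLinear.Build K 'M[K]_d
  'M[K]_(m * p, n * q) _ (tens_map f g) tens_map_is_linear.

Lemma tens_map_tens x y : tens_map f g (x^T *m y) = f x *t g y.
Proof.
rewrite (linear_basis f x) tensmx_suml; apply: eq_bigr => i _.
rewrite (linear_basis g y) tensmx_sumr; apply: eq_bigr => j _.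
by rewrite tensmxZl tensmxZr scalerA mxE big_ord1 mxE.
Qed.
End TensMap.

Lemma matrix_sum_basis (T : 'M[K]_d) :
  T = \sum_i \sum_j T i j *: ((E i)^T *m E j).
Proof.
rewrite [LHS]matrix_sum_delta; apply: eq_bigr => i _; apply: eq_bigr => j _.
by rewrite trmx_delta mul_delta_mx.
Qed.

Lemma linear_matrix_basis (V : lmodType K) (f : {linear 'M[K]_d -> V}) T :
  f T = \sum_i \sum_j T i j *: f ((E i)^T *m E j).
Proof.
rewrite {1}(matrix_sum_basis T) linear_sum; apply: eq_bigr => i _.
by rewrite linear_sum; apply: eq_bigr => j _; rewrite linearZ.
Qed.

(** Stated for six maps so that it covers both products of representations and the action of a
    representation on H (x) V. *)
Lemma tens_map_mul m n p q r s
  (F : {linear 'rV[K]_d -> 'M[K]_(r, m)}) (G : {linear 'rV[K]_d -> 'M[K]_(s, p)})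
  (f' : {linear 'rV[K]_d -> 'M[K]_(r, n)}) (g' : {linear 'rV[K]_d -> 'M[K]_(s, q)})
  (f : {linear 'rV[K]_d -> 'M[K]_(m, n)}) (g : {linear 'rV[K]_d -> 'M[K]_(p, q)})
  T U :
  (forall a x, F a *m f x = f' (mul a x)) ->
  (forall a x, G a *m g x = g' (mul a x)) ->
  tens_map F G T *m tens_map f g U = tens_map f' g' (tmul A T U).
Proof.
move=> Ff Gg; rewrite tmulE {1}/tens_map mulmx_suml [RHS]linear_sum.
apply: eq_bigr => i _; rewrite mulmx_suml [RHS]linear_sum.
apply: eq_bigr => j _; rewrite [RHS]linearZ -scalemxAl; congr (_ *: _).
rewrite [RHS](linear_matrix_basis (tens_map f' g' \o mulmxr (L (E j)) \o
  mulmx (L (E i))^T)) mulmx_sumr; apply: eq_bigr => k _.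
rewrite mulmx_sumr; apply: eq_bigr => l _ /=.
rewrite -scalemxAr tensmx_mul Ff Gg; congr (_ *: _).
by rewrite mulmxA -trmx_mul -mulLE -mulmxA -mulLE tens_map_tens.
Qed.

Definition tens_module (V W : hmodule K d) : hmodule K d :=
  HModule (fun k => tens_map (rep V) (rep W) (comulc A k)).

Lemma rep_tens V W h : rep (tens_module V W) h = tens_map (rep V) (rep W) (comul A h).
Proof.
rewrite [RHS](linear_basis (tens_map (rep V) (rep W) \o comul A)).
by apply: eq_bigr => i _; rewrite /= comul_basis.
Qed.

Lemma tens_is_module V W :
  is_module A V -> is_module A W -> is_module A (tens_module V W).
Proof.
move=> [VM V1] [WM W1]; split=> [a b|].
  rewrite !rep_tens comul_mul // (tens_map_mul _ _ (f' := rep V) (g' := rep W)) //.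
    by move=> x y; apply/esym/VM.
  by move=> x y; apply/esym/WM.
rewrite rep_tens comul_one // tens_map_tens -tensmx1.
by congr (_ *t _).
Qed.

Lemma character_tens V W : character (tens_module V W) = character V ** character W.
Proof.
apply: pair_inj => h; rewrite pair_character rep_tens pair_conv.
rewrite (raddf_sum (@mxtrace _ _)).
under eq_bigr do rewrite (raddf_sum (@mxtrace _ _)).
rewrite mxE exchange_big /=; apply: eq_bigr => j _.
rewrite mxE mulr_suml; apply: eq_bigr => i _.
by rewrite mxtraceZ mxtrace_tens !rep_basis !mxE mulrA [_ * comul _ _ _ _]mulrC.
Qed.

(** Transposed because modules act on column vectors. *)
Definition regular_module : hmodule K d := HModule (fun i => (L (E i))^T).
Local Notation Reg := regular_module.

Lemma rep_regular h : rep Reg h = (L h)^T.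
Proof. by rewrite [RHS](linear_basis (trmx \o L)). Qed.

Lemma regular_is_module : is_module A Reg.
Proof.
split=> [a b|]; last by rewrite rep_regular mulL1 // trmx1.
by rewrite !rep_regular mulL_mul // trmx_mul.
Qed.

Lemma rep_regular_tr a x : rep Reg a *m x^T = (mul a x)^T.
Proof. by rewrite rep_regular -trmx_mul -mulLE. Qed.

Section RegularTensor.
Variable V : hmodule K d.
Hypothesis HV : is_module A V.
Local Notation n := (mdim V).

(* The operator [x (x) v |-> x_1 (x) f x_2 v]: for [f = rep V] it trivialises the
   action of [H] on the second factor of [Reg (x) V], and [f = rep V \o S] gives
   its inverse. *)
Definition regular_twist (f : 'rV[K]_d -> 'M[K]_n) : 'M[K]_(d * n) :=
  \sum_j \sum_k \sum_l comulc A j k l *: (delta_mx k j *t f (E l)).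

Lemma regular_twist_tens (f : {linear 'rV[K]_d -> 'M[K]_n}) x (B : 'M[K]_n) :
  regular_twist f *m (x^T *t B) =
  \sum_k \sum_l comul A x k l *: ((E k)^T *t (f (E l) *m B)).
Proof.
transitivity (\sum_j x 0 j *: (\sum_k \sum_l comul A (E j) k l *: ((E k)^T *t (f (E l) *m B)))).
  rewrite /regular_twist mulmx_suml; apply: eq_bigr => j _.
  rewrite mulmx_suml scaler_sumr; apply: eq_bigr => k _.
  rewrite mulmx_suml scaler_sumr; apply: eq_bigr => l _.
  rewrite -scalemxAl tensmx_mul scalerA mulrC -scalerA comul_basis.
  congr (_ *: _); rewrite -tensmxZl; congr (_ *t _).
  rewrite /basis_vec trmx_delta; apply/matrixP=> a b; rewrite ord1 !mxE.
  rewrite (bigD1 j) //= big1 => [|i ij]; last by rewrite !mxE (negPf ij) andbF mul0r.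
  by rewrite !mxE !eqxx !andbT addr0 mulrC.
under eq_bigr do rewrite scaler_sumr.
rewrite exchange_big; apply: eq_bigr => k _ /=.
under eq_bigr do rewrite scaler_sumr.
rewrite exchange_big; apply: eq_bigr => l _ /=.
rewrite comulE scaler_suml; apply: eq_bigr => j _.
by rewrite scalerA comul_basis.
Qed.

Lemma eq_tens_basis p (X Y : 'M[K]_(p, d * n)) :
  (forall j, X *m ((E j)^T *t 1%:M) = Y *m ((E j)^T *t (1%:M : 'M_n))) -> X = Y.
Proof.
move=> XY; rewrite -[X]mulmx1 -[Y]mulmx1 -tensmx1.
rewrite (matrix_sum_basis 1%:M) tensmx_suml !mulmx_sumr; apply: eq_bigr => i _.
rewrite tensmx_suml !mulmx_sumr; apply: eq_bigr => j _.
rewrite tensmxZl -!scalemxAr -[X in _ *t X]mulmx1 -tensmx_mul !mulmxA.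
by rewrite XY.
Qed.

(** H (x) V is a free module of rank dim V: the twist carries the action on the first factor alone
    to the diagonal action. *)
Lemma rep_regular_tens h :
  \tr (rep (tens_module Reg V) h) = n%:R * \tr (rep Reg h).
Proof.
have [repM rep1] := HV.
pose Psi := regular_twist (rep V); pose Psi' := regular_twist (rep V \o mulmxr S).
(* On x (x) v the composite gives x_1 (x) S x_2 x_3 v = x (x) v. *)
have PsiK : Psi' *m Psi = 1%:M.
  apply: eq_tens_basis => j; rewrite -mulmxA mul1mx regular_twist_tens mulmx_sumr.
  transitivity (\sum_k \sum_l comul A (E j) k l *: \sum_a \sum_b
    comulc A k a b *: ((E a)^T *t (rep V (mul (E b *m S) (E l))))).
    apply: eq_bigr => k _; rewrite mulmx_sumr; apply: eq_bigr => l _.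
    rewrite -scalemxAr mulmx1 regular_twist_tens; congr (_ *: _).
    apply: eq_bigr => a _; apply: eq_bigr => b _.
    by rewrite comul_basis; congr (_ *: (_ *t _)); apply/esym/repM.
  rewrite (sum_coassoc HA (fun a b l => (E a)^T *t rep V (mul (E b *m S) (E l)))).
  transitivity (\sum_k \sum_l comul A (E j) k l *:
      (counitc A 0 l *: ((E k)^T *t (1%:M : 'M_n)))); last first.
    rewrite sum_counitr // {2}(row_sum_basis (E j)) linear_sum tensmx_suml.
    by apply: eq_bigr => i _; rewrite linearZ tensmxZl.
  apply: eq_bigr => k _; apply: eq_bigr => l _; congr (_ *: _).
  have := sum_antipodel HA (E l); rewrite counitE pair_basis comul_basis.
  move/(congr1 (rep V)); rewrite linearZ /= rep1 -tensmxZr => <-.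
  rewrite linear_sum tensmx_sumr; apply: eq_bigr => a _.
  rewrite linear_sum tensmx_sumr; apply: eq_bigr => b _.
  by rewrite linearZ tensmxZr.
(* Both sides send x (x) v to h_1 x_1 (x) h_2 x_2 v. *)
have PsiP : rep (tens_module Reg V) h *m Psi = Psi *m (rep Reg h *t 1%:M).
  apply: eq_tens_basis => j; rewrite -!mulmxA tensmx_mul mul1mx.
  rewrite rep_regular_tr !regular_twist_tens.
  have tm x : \sum_k \sum_l comul A x k l *: ((E k)^T *t (rep V (E l) *m 1%:M)) =
     tens_map trmx (rep V) (comul A x).
    by apply: eq_bigr => k _; apply: eq_bigr => l _; rewrite mulmx1.
  rewrite !tm rep_tens comul_mul //.
  apply: (@tens_map_mul _ _ _ _ _ _ (rep Reg) (rep V) trmx (rep V) trmx (rep V)).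
    exact: rep_regular_tr.
  by move=> x y; apply/esym/repM.
have PsiKV := mulmx1C PsiK.
rewrite -[rep (tens_module _ _) h]mulmx1 -PsiKV mulmxA PsiP -mulmxA mxtrace_mulC.
by rewrite -mulmxA PsiK mulmx1 mxtrace_tens mxtrace1 mulrC.
Qed.
End RegularTensor.

(* [h_1 <chi_V, h_2>] *)
Definition partial_trace (V : hmodule K d) h : 'rV[K]_d :=
  character V *m (comul A h)^T.
End TensorModules.

(** * Involutivity of the antipode *)

Section LarsonRadford.
Variables (K : numFieldType) (d : nat) (A : hopf_data K d).
Hypotheses (HA : is_hopf A) (Hss : semisimple A).
Local Notation E i := (basis_vec K i).
Local Notation L := (mulL A).
Local Notation S := (antic A).
Local Notation mul := (hmul A).
Local Notation "p ** q" := (conv A p q) (at level 40, left associativity).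
#[local] Opaque comul hmul conv harp.
Variables Lam lam : 'rV[K]_d.
Hypotheses (HLam : integral_H A Lam) (Hlam : integral_Hstar A lam).
Hypothesis lam_Lam : pair lam Lam = 1.
Hypothesis lam_one : pair lam (hone A) = d%:R.
Local Notation D := (comul A Lam).
Local Notation G := (gram A lam).

(* A complement of the left ideal [ker counit] is spanned by a left integral
   [w] with [counit w = 1], and [Lam = Lam * w = counit Lam *: w]. *)
Lemma counit_integral_neq0 : counit A Lam != 0.
Proof.
pose U := kermx (counitc A)^T.
have memU x : (x <= U)%MS = (counit A x == 0).
  rewrite (sameP sub_kermxP eqP); apply/eqP/eqP => [x0|x0].
    by rewrite counitE pairC pairE x0 mxE.
  apply/rowP=> i; rewrite (ord1 i) [RHS]mxE -pairE pairC -counitE.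
  by rewrite x0.
have lU : left_ideal A U.
  move=> h u; rewrite !memU counit_mul // => /eqP->; by rewrite mulr0.
have [W [lW [/eqmxP UW0 /eqmxP UW1]]] := Hss lU.
have : (hone A <= U + W)%MS by rewrite UW1 submx1.
case/sub_addsmxP => [[u w]] /= onew.
set x := u *m U in onew; set y := w *m W in onew.
have xU : (x <= U)%MS by apply: submxMl.
have yW : (y <= W)%MS by apply: submxMl.
have ey : counit A y = 1.
  rewrite -(counit_one HA) onew !counitE pairDr -!counitE.
  by move: xU; rewrite memU => /eqP->; rewrite add0r.
have hy h : mul h y = counit A h *: y.
  apply/eqP; rewrite -subr_eq0 -submx0 -UW0 sub_capmx memU.
  have -> : counit A (mul h y - counit A h *: y) = 0.
    rewrite counitE -scaleNr pairDr pairZr -!counitE counit_mul // ey.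
    by rewrite !mulr1 subrr.
  rewrite eqxx /= -scaleNr.
  by apply: addmx_sub; [apply: lW | apply: scalemx_sub].
apply/negP=> /eqP e0; have := (HLam y).2; rewrite hy e0 scale0r ey scale1r.
by move=> L0; move: lam_Lam; rewrite -L0 pairC pair0l => /eqP; rewrite eq_sym oner_eq0.
Qed.

Let Q := S *m S.
Let QQ : Q *m Q = 1%:M. Proof. exact: (antipode4 HA HLam Hlam lam_Lam). Qed.

Let Dunit : D \in unitmx.
Proof. exact: (comul_integral_unit HA HLam Hlam lam_Lam). Qed.
Let Gunit : G \in unitmx.
Proof. exact: (gram_unit HA HLam Hlam lam_Lam). Qed.

(* [Q] is the Nakayama automorphism of [lam], hence multiplicative. *)
Let lam_mulC x y : pair lam (mul x y) = pair lam (mul (y *m Q) x).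
Proof.
rewrite !gramE // -mulmxA.
have := gram_tr HA HLam Hlam lam_Lam; rewrite -/Q => GT.
have -> : y *m Q *m G = y *m G^T by rewrite GT !mulmxA.
transitivity ((x *m (G *m y^T))^T 0 0); first by rewrite [RHS]mxE.
by rewrite !trmx_mul trmxK.
Qed.

Let Lam_convC p q : pair (p ** q) Lam = pair (q ** (p *m Q^T)) Lam.
Proof.
rewrite !pair_conv trmx_mul trmxK (mulmxA (q *m D) Q).
have := comul_integral_tr HA HLam Hlam lam_Lam; rewrite -mulmxA -/Q => DT.
rewrite -(mulmxA q D Q) -DT.
transitivity ((p *m D *m q^T)^T 0 0); first by rewrite [RHS]mxE.
by rewrite !trmx_mul trmxK mulmxA.
Qed.

(** Under [lam], the product x y may be cycled past a third element as a whole or one factor at a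
    time; nondegeneracy of [G] concludes. *)
Let mulQ x y : mul x y *m Q = mul (x *m Q) (y *m Q).
Proof.
apply: (row_free_inj (A := G)); first by rewrite row_free_unit.
apply/rowP=> i.
have e z : (z *m G) 0 i = pair lam (mul z (E i)).
  by rewrite gramE // /basis_vec trmx_delta -colE [RHS]mxE.
rewrite !e -lam_mulC -hmulA // lam_mulC -hmulA // lam_mulC hmulA //.
Qed.

Let convQ p q : (p ** q) *m Q^T = (p *m Q^T) ** (q *m Q^T).
Proof.
apply: trmx_inj; apply: (row_full_inj (A := D)).
  by rewrite row_full_unit.
apply/colP=> i.
have e z : (D *m z^T) i 0 = pair (E i ** z) Lam.
  by rewrite pair_conv -mulmxA basis_mulmx [RHS]mxE.
by rewrite !e -Lam_convC convA // Lam_convC convA // Lam_convC convA.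
Qed.

Lemma dim_neq0 : d%:R != 0 :> K.
Proof.
have [d0|] := posnP d; last by rewrite pnatr_eq0 -lt0n.
move: lam_Lam; rewrite /pair; move: Lam lam; rewrite d0 => x y.
by rewrite big_ord0 => /eqP; rewrite eq_sym oner_eq0.
Qed.

Lemma antipode_involutive : S *m S = 1%:M.
Proof.
pose chi := character (regular_module A).
have d0 := dim_neq0.
have chichi : chi ** chi = d%:R *: chi.
  rewrite -character_tens; apply: pair_inj => h; rewrite pairZl !pair_character.
  by rewrite rep_regular_tens //; exact: regular_is_module.
have chi_tr h : pair chi h = \tr (L h) by rewrite pair_character rep_regular mxtrace_tr.
(* [Q] is a multiplicative involution, so [L (h *m Q)] is conjugate to [L h]. *)
have chiQ : chi *m Q^T = chi.
  apply: pair_inj => h; rewrite pairE -mulmxA -trmx_mul -pairE !chi_tr.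
  have -> : L (h *m Q) = Q *m L h *m Q.
    apply/row_matrixP=> i; rewrite !rowE -mulLE; set x := delta_mx _ _.
    rewrite (mulmxA x (Q *m L h) Q) (mulmxA x Q (L h)) -(mulLE A h (x *m Q)).
    by rewrite mulQ -(mulmxA x Q Q) QQ mulmx1.
  by rewrite -mulmxA mxtrace_mulC -mulmxA QQ mulmx1.
pose p := d%:R^-1 *: chi.
have pp : p ** p = p.
  by rewrite /p !(convZl, convZr) chichi !scalerA -mulrA mulVf ?mulr1.
have Lpp : convL A p *m convL A p = convL A p by rewrite -convL_conv // pp.
have QTQT : Q^T *m Q^T = 1%:M by rewrite -trmx_mul QQ trmx1.
have LpQ : convL A p *m Q^T = Q^T *m convL A p.
  apply/row_matrixP=> i; rewrite !rowE !mulmxA -!convLE convQ.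
  by rewrite /p -scalemxAl chiQ.
(* [L Lam] is the rank one map sending x to counit x times [Lam]. *)
have trLam : pair chi Lam = counit A Lam.
  have -> : pair chi Lam = \tr ((counitc A)^T *m Lam).
    rewrite chi_tr; congr (\tr _); apply/row_matrixP=> i.
    rewrite !rowE -mulLE mulmxA (HLam _).2 counitE pairC pairE.
    by rewrite [X in _ = X *m _]mx11_scalar mul_scalar_mx.
  by rewrite mxtrace_mulC counitE pairC pairE trace_mx11.
have trp : \tr (convL A p *m Q^T) = counit A Lam.
  rewrite mxtrace_mulC trmx_mul (conv_antipode_trace HA HLam Hlam lam_Lam).
  by rewrite /p pairZl lam_one trLam mulrA mulfV ?mul1r.
have trQ : \tr Q = d%:R * counit A Lam.
  have := antipode_trace HA HLam Hlam lam_Lam (hone A).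
  by rewrite mulL1 // mulmx1 -/Q lam_one mulrC.
have [a [b [tr1 _ _ _]]] := mxtrace_involution Lpp QTQT LpQ.
have [a' [b' [tr1' tr2' a0 b0]]] :=
  mxtrace_involution (mulmx1 _) QQ (etrans (mul1mx Q) (esym (mulmx1 Q))).
rewrite mul1mx in tr1' a0 b0; rewrite mxtrace1 in tr2'.
have ab : (a'%:Z - b'%:Z)%R = (d%:Z * (a%:Z - b%:Z)).
  apply: (@intr_inj K); rewrite rmorphB /= -!pmulrn -tr1' trQ -trp tr1.
  by rewrite rmorphM rmorphB /= -!pmulrn.
have dab : d = (a' + b')%N by apply/eqP; rewrite -(eqr_nat K) natrD tr2'.
have ab0 : a != b.
  apply: contra counit_integral_neq0 => /eqP ab1.
  by rewrite -trp tr1 ab1 subrr.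
(* As a' + b' = d and a' - b' = d (a - b) with a - b nonzero, one of a', b' vanishes. *)
have [/b0 QE|b1] := eqVneq b' 0%N; first exact: QE.
have [/a0 QE|a1] := eqVneq a' 0%N; last by exfalso; move: ab dab ab0 b1 a1; nia.
(* S ^ 2 = -1 is excluded because [S] fixes 1. *)
have : hone A *m Q = - hone A.
  by rewrite QE mulmxN mulmx1.
rewrite mulmxA !(antipode_one HA) => /esym/eqP; rewrite -subr_eq0 -opprD oppr_eq0.
rewrite -mulr2n -scaler_nat scaler_eq0 pnatr_eq0 /= => /eqP one0.
have := lam_one; rewrite one0 pairC pair0l => /eqP; rewrite eq_sym.
by rewrite (negPf d0).
Qed.
End LarsonRadford.

(** * The character ring *)

Section CompositionSeries.
Variables (K : fieldType) (d : nat) (A : hopf_data K d).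
Hypothesis HA : is_hopf A.
Local Notation mul := (hmul A).
Local Notation "p ** q" := (conv A p q) (at level 40, left associativity).
#[local] Opaque comul hmul conv harp.

Section SubQuotient.
Variable V : hmodule K d.
Hypothesis HV : is_module A V.
Variable U : 'M[K]_(mdim V).
Hypothesis HU : submodule U.

(** [in_submod] and [val_submod] are coordinates on row spaces while modules act on columns, whence
    the transpositions. *)
Definition sub_hmodule : hmodule K d :=
  HModule (fun i => (in_submod U (val_submod 1%:M *m (mact V i)^T))^T).
Definition quo_hmodule : hmodule K d :=
  HModule (fun i => (in_factmod U (val_factmod 1%:M *m (mact V i)^T))^T).

Lemma rep_sub h : rep sub_hmodule h = (in_submod U (val_submod 1%:M *m (rep V h)^T))^T.
Proof.
rewrite [RHS](linear_basis (trmx \o in_submod U \o mulmx (val_submod 1%:M) \o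
  trmx \o rep V)).
by apply: eq_bigr => i _; rewrite /= rep_basis.
Qed.

Lemma rep_quo h : rep quo_hmodule h = (in_factmod U (val_factmod 1%:M *m (rep V h)^T))^T.
Proof.
rewrite [RHS](linear_basis (trmx \o in_factmod U \o mulmx (val_factmod 1%:M) \o
  trmx \o rep V)).
by apply: eq_bigr => i _; rewrite /= rep_basis.
Qed.

Lemma sub_is_module : is_module A sub_hmodule.
Proof.
have [repM rep1] := HV; split=> [a b|]; last first.
  by rewrite rep_sub rep1 trmx1 mulmx1 val_submodK trmx1.
rewrite !rep_sub repM -trmx_mul; congr (_^T).
rewrite trmx_mul mulmxA -[in LHS](@in_submodK _ _ U _ (_ *m (rep V b)^T)); last first.
  exact: submx_trans (submxMr _ (val_submodP _)) (HU b).
set Y := in_submod U (val_submod 1%:M *m (rep V b)^T); set M := (rep V a)^T.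
transitivity (in_submod U (Y *m (val_submod 1%:M *m M))).
  by rewrite mulmxA -val_submodE.
by rewrite in_submodE [in RHS]in_submodE [RHS]mulmxA.
Qed.

Lemma quo_is_module : is_module A quo_hmodule.
Proof.
have [repM rep1] := HV; split=> [a b|]; last first.
  by rewrite rep_quo rep1 trmx1 mulmx1 val_factmodK trmx1.
rewrite !rep_quo repM -trmx_mul; congr (_^T).
rewrite trmx_mul mulmxA -[in LHS](add_sub_fact_mod U (_ *m (rep V b)^T)).
rewrite mulmxDl linearD /=.
have /eqP -> : in_factmod U (val_submod (in_submod U
    (val_factmod (1%:M : 'M_(\rank (cokermx U))) *m (rep V b)^T)) *m (rep V a)^T) == 0.
  rewrite in_factmod_eq0.
  exact: submx_trans (submxMr _ (val_submodP _)) (HU a).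
rewrite add0r.
set Y := in_factmod U (val_factmod 1%:M *m (rep V b)^T); set M := (rep V a)^T.
transitivity (in_factmod U (Y *m (val_factmod 1%:M *m M))).
  by rewrite mulmxA -val_factmodE.
by rewrite in_factmodE [in RHS]in_factmodE [RHS]mulmxA.
Qed.

Lemma character_sub_quo : character V = character sub_hmodule + character quo_hmodule.
Proof.
apply/rowP=> i; rewrite !mxE /= !mxtrace_tr addrC.
rewrite -[in_factmod _ _]mulmxA mxtrace_mulC -val_factmodE addrC.
rewrite -[in_submod _ _]mulmxA mxtrace_mulC -val_submodE.
by rewrite -mxtraceD add_sub_fact_mod mxtrace_tr.
Qed.
End SubQuotient.

Lemma inRH0 : inRH A 0.
Proof.
by exists 0%N, (fun i => regular_module A), (fun i => 0); split=> [[]|];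
  rewrite ?big_ord0.
Qed.

Lemma inRH_char V : irreducible A V -> inRH A (character V).
Proof.
by move=> irrV; exists 1%N, (fun _ => V), (fun _ => 1); rewrite big_ord1 scale1r.
Qed.

Lemma inRHZ a p : inRH A p -> inRH A (a *: p).
Proof.
move=> [m [Vs [c [irr ->]]]]; exists m, Vs, (fun k => a * c k); split=> //.
by rewrite scaler_sumr; apply: eq_bigr => k _; rewrite scalerA.
Qed.

Lemma inRHD p q : inRH A p -> inRH A q -> inRH A (p + q).
Proof.
move=> [m [Vs [c [irr ->]]]] [m' [Vs' [c' [irr' ->]]]].
pose pick T (f : 'I_m -> T) (f' : 'I_m' -> T) (k : 'I_(m + m')) :=
  match split k with inl i => f i | inr j => f' j end.
exists (m + m')%N, (pick _ Vs Vs'), (pick _ c c'); split=> [k|].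
  by rewrite /pick; case: (split k).
rewrite big_split_ord /=; congr (_ + _); apply: eq_bigr => k _; rewrite /pick.
  by rewrite -[lshift _ k]/(unsplit (inl k)) unsplitK.
by rewrite -[rshift _ k]/(unsplit (inr k)) unsplitK.
Qed.

Lemma inRH_sum I r (P : pred I) (F : I -> 'rV[K]_d) :
  (forall i, P i -> inRH A (F i)) -> inRH A (\sum_(i <- r | P i) F i).
Proof. by move=> RF; apply: big_rec => [|i x Pi Rx]; [apply: inRH0 | apply/inRHD/Rx/RF]. Qed.

(** Characters are additive on a submodule and its quotient, so induction on the dimension applies.
    This puts characters of tensor products, hence products of characters, in R(H). *)
Lemma composition_series V : is_module A V -> exists m (Vs : 'I_m -> hmodule K d),
  (forall k, irreducible A (Vs k)) /\ character V = \sum_k character (Vs k).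
Proof.
have [n] := ubnP (mdim V); elim: n V => // n IH V /ltnSE leVn HV.
have [V0|Vpos] := posnP (mdim V).
  exists 0%N, (fun i => V); split=> [[]//|]; rewrite big_ord0.
  apply/rowP=> i; rewrite !mxE /mxtrace; move: (mact V i); rewrite V0 => X.
  by rewrite big_ord0.
have [irrV|redV] := pselect (irreducible A V).
  by exists 1%N, (fun _ => V); rewrite big_ord1.
have [U [HU U0 U1]] : exists U : 'M[K]_(mdim V),
    [/\ submodule U, ~ (U == (0 : 'M_(mdim V)))%MS & ~ (U == 1%:M)%MS].
  apply: contrapT => noU; apply: redV; split=> // U HU.
  have [|U0] := pselect (U == (0 : 'M_(mdim V)))%MS; first by left.
  have [|U1] := pselect (U == 1%:M)%MS; first by right.
  by case: noU; exists U.
have rk0 : (0 < \rank U)%N.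
  rewrite lt0n mxrank_eq0; apply/eqP=> U00; apply: U0; rewrite U00.
  by rewrite submx_refl.
have rk1 : (\rank U < mdim V)%N.
  rewrite ltn_neqAle rank_leq_row andbT; apply/eqP=> rkU; apply: U1.
  by rewrite submx1 sub1mx /row_full rkU eqxx.
have [|m [Vs [irr def]]] := IH _ _ (sub_is_module HV HU).
  by rewrite /=; apply: leq_trans rk1 leVn.
have [|m' [Vs' [irr' def']]] := IH _ _ (quo_is_module HV HU).
  by rewrite /= mxrank_coker; apply: leq_trans leVn; rewrite ltn_subrL rk0.
exists (m + m')%N, (fun k => match split k with inl i => Vs i | inr j => Vs' j end).
split=> [k|]; first by case: (split k).
rewrite (character_sub_quo U) def def' big_split_ord /=.
congr (_ + _); apply: eq_bigr => k _.
  by rewrite -[lshift _ k]/(unsplit (inl k)) unsplitK.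
by rewrite -[rshift _ k]/(unsplit (inr k)) unsplitK.
Qed.

Lemma inRH_character V : is_module A V -> inRH A (character V).
Proof.
move=> /composition_series [m [Vs [irr ->]]]; apply: inRH_sum => k _.
exact: inRH_char.
Qed.

Lemma inRH_conv p q : inRH A p -> inRH A q -> inRH A (p ** q).
Proof.
move=> [m [Vs [c [irr ->]]]] [m' [Vs' [c' [irr' ->]]]].
rewrite conv_suml //; apply: inRH_sum => k _.
rewrite conv_sumr //; apply: inRH_sum => l _.
rewrite convZl // convZr //; do 2 apply: inRHZ; rewrite -character_tens.
apply/inRH_character/tens_is_module => //.
  by case: (irr k).
by case: (irr' l).
Qed.

Lemma inRH_tracelike p x y : inRH A p -> pair p (mul x y) = pair p (mul y x).
Proof.
move=> [m [Vs [c [irr ->]]]]; rewrite !pair_suml; apply: eq_bigr => k _.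
by rewrite !pairZl character_tracelike //; case: (irr k).
Qed.
End CompositionSeries.

(** * Schur's lemma and central elements *)

Section Schur.
Variables (K : numClosedFieldType) (d : nat) (A : hopf_data K d).
Local Notation mul := (hmul A).
Variable V : hmodule K d.
Hypothesis irrV : irreducible A V.

Lemma schur (M : 'M[K]_(mdim V)) :
  (forall h, M *m rep V h = rep V h *m M) -> exists a, M = a%:M.
Proof.
have [HV Vpos Virr] := irrV => comM.
have [a /rootP aev] : exists a, root (char_poly M^T) a.
  by apply/closed_rootP; rewrite size_char_poly -lt0n.
have ev : eigenvalue M^T a by rewrite eigenvalue_root_char; apply/rootP.
have stab : submodule (eigenspace M^T a).
  move=> h; apply: comm_mx_stable_eigenspace; rewrite /comm_mx -!trmx_mul.
  by rewrite comM.
case: (Virr _ stab) => [/eqmxP U0|/eqmxP U1].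
  by move: ev; rewrite /eigenvalue -submx0 U0 submx_refl.
exists a; apply: trmx_inj; rewrite tr_scalar_mx.
have /eigenspaceP : (1%:M <= eigenspace M^T a)%MS by rewrite U1.
by rewrite mul1mx scalemx1.
Qed.

Lemma character_central z w : (forall x, mul z x = mul x z) ->
  pair (character V) (mul z w) =
  pair (character V) z * pair (character V) w / (mdim V)%:R.
Proof.
have [HV Vpos _] := irrV => zC; have [repM _] := HV.
have [h|a za] := schur (M := rep V z); first by rewrite -!repM zC.
rewrite !pair_character repM za mul_scalar_mx mxtraceZ mxtrace_scalar.
by rewrite -[a *+ _]mulr_natr [RHS]mulrAC mulfK // pnatr_eq0 -lt0n.
Qed.
End Schur.

(** * The trace form on R(H) and the corner of a primitive idempotent *)

Section CharacterRing.
Variables (K : numClosedFieldType) (d : nat) (A : hopf_data K d).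
Hypotheses (HA : is_hopf A) (Hss : semisimple A).
Local Notation E i := (basis_vec K i).
Local Notation L := (mulL A).
Local Notation S := (antic A).
Local Notation mul := (hmul A).
Local Notation "p ** q" := (conv A p q) (at level 40, left associativity).
#[local] Opaque comul hmul conv harp.
Variables Lam lam : 'rV[K]_d.
Hypotheses (HLam : integral_H A Lam) (Hlam : integral_Hstar A lam).
Hypothesis lam_Lam : pair lam Lam = 1.
Hypothesis lam_one : pair lam (hone A) = d%:R.
Local Notation D := (comul A Lam).
Local Notation R := (inRH A).

Let SS : S *m S = 1%:M.
Proof. exact: (antipode_involutive HA Hss HLam Hlam lam_Lam lam_one). Qed.

Lemma comul_integral_sym : D^T = D.
Proof. by rewrite (comul_integral_tr HA HLam Hlam lam_Lam) -mulmxA SS mulmx1. Qed.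

Lemma integral_convC p q : pair (p ** q) Lam = pair (q ** p) Lam.
Proof.
rewrite !pair_conv; transitivity ((p *m D *m q^T)^T 0 0); first by rewrite [RHS]mxE.
by rewrite !trmx_mul trmxK comul_integral_sym mulmxA.
Qed.

Lemma counit_integral : counit A Lam = 1.
Proof.
have := antipode_trace HA HLam Hlam lam_Lam (hone A).
rewrite mulL1 // mulmx1 SS mxtrace1 lam_one => /esym/eqP.
by rewrite -subr_eq0 -{2}[d%:R]mul1r -mulrBl mulf_eq0 (negPf (dim_neq0 lam_Lam)) orbF subr_eq0 => /eqP.
Qed.

Lemma integral_character : lam = character (regular_module A).
Proof.
apply: pair_inj => h; rewrite pair_character rep_regular mxtrace_tr.
have := antipode_trace HA HLam Hlam lam_Lam h.
by rewrite SS mul1mx counit_integral mul1r.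
Qed.

Lemma convL_trace p : \tr (convL A p) = d%:R * pair p Lam.
Proof.
have := conv_antipode_trace HA HLam Hlam lam_Lam p.
by rewrite -trmx_mul SS trmx1 mul1mx lam_one.
Qed.

(** As S ^ 2 = 1, an [x] to the right or left of Lam_2 moves to an S x on the same side of Lam_1,
    and [p] is a trace. *)
Lemma harp_central p x : R p -> mul (harp A Lam p) x = mul x (harp A Lam p).
Proof.
move=> Rp; rewrite harpE (mulRE A x) (mulLE A x).
have e y : (p *m (L y)^T) = (p *m (mulR A y)^T).
  apply/rowP=> i.
  have e1 (M : 'M_d) : (p *m M^T) 0 i = pair p (E i *m M).
    by rewrite pairE trmx_mul mulmxA /basis_vec trmx_delta -colE [RHS]mxE.
  by rewrite !e1 -mulLE -mulRE inRH_tracelike.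
have xSS : x = x *m S *m S by rewrite -mulmxA SS mulmx1.
rewrite -!mulmxA (comulL_integral HA HLam) [RHS]mulmxA e -[RHS]mulmxA {1}xSS.
by rewrite -(comulR_integral HA HLam).
Qed.

Lemma integral_series : exists N (Vs : 'I_N -> hmodule K d),
  (forall k, irreducible A (Vs k)) /\ lam = \sum_k character (Vs k).
Proof.
by rewrite integral_character; apply/composition_series/regular_is_module.
Qed.

Lemma eq0_integral x : (forall w, pair lam (mul x w) = 0) -> x = 0.
Proof.
move=> x0; apply: (row_free_inj (A := gram A lam)).
  by rewrite row_free_unit (gram_unit HA HLam Hlam lam_Lam).
rewrite /= mul0mx; apply/rowP=> i; rewrite [RHS]mxE -(x0 (E i)) gramE //.
by rewrite /basis_vec trmx_delta -colE [RHS]mxE.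
Qed.

Lemma harp_inj : injective (harp A Lam).
Proof.
move=> p q; rewrite !harpE; apply: row_free_inj.
by rewrite row_free_unit (comul_integral_unit HA HLam Hlam lam_Lam).
Qed.

(** The element z = Lam <- p is central and each irreducible character vanishes on it, hence on z w
    by Schur; [lam] is a sum of such characters and its form is nondegenerate. *)
Lemma inRH_nondegenerate p :
  R p -> (forall q, R q -> pair (p ** q) Lam = 0) -> p = 0.
Proof.
move=> Rp p0; apply: harp_inj; rewrite [RHS]harpE mul0mx.
have [N [Vs [irr lamE]]] := integral_series.
apply: eq0_integral => w; rewrite lamE pair_suml big1 // => k _.
rewrite (character_central (irr k)) => [|x]; last exact: harp_central.
by rewrite pair_harp p0 ?mul0r //; apply: inRH_char.
Qed.

Section Corner.
Variable f : 'rV[K]_d.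
Hypothesis Hf : primitive_idem A f.
Let Rf : R f. Proof. by case: Hf => [[]]. Qed.
Let ff : f ** f = f. Proof. by case: Hf => [[]]. Qed.
Let f0 : f != 0. Proof. by case: Hf => [[]]. Qed.

Lemma inRHB p q : R p -> R q -> R (p - q).
Proof. by move=> Rp Rq; rewrite -scaleN1r; apply/inRHD/inRHZ. Qed.

Let corner p := [/\ R p, f ** p = p & p ** f = p].

Let corner_mul p q : corner p -> corner q -> corner (p ** q).
Proof.
move=> [Rp fp pf] [Rq fq qf]; split; first exact: inRH_conv.
  by rewrite -convA // fp.
by rewrite convA // qf.
Qed.

Let corner_ff q : R q -> corner (f ** q ** f).
Proof.
move=> Rq; split; first by do 2! (apply: inRH_conv => //).
  by rewrite -!convA // ff.
by rewrite convA // ff.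
Qed.

(** An idempotent p of the corner other than 0 and [f] would split [f] as p + (f - p), against
    primitivity. *)
Let corner_local_conv x : corner x -> exists a, nilpotentmx (convL A x - a *: convL A f).
Proof.
move=> cx.
apply: (@corner_local _ _ (fun M => exists2 p, corner p & M = convL A p)).
- move=> a _ _ [p [Rp fp pf] ->] [q [Rq fq qf] ->]; exists (a *: p + q).
    split; first by apply/inRHD/Rq/inRHZ.
      by rewrite convDr // convZr // fp fq.
    by rewrite convDl // convZl // pf qf.
  by rewrite linearP.
- move=> _ _ [p cp ->] [q cq ->]; exists (q ** p); first exact: corner_mul.
  by rewrite convL_conv.
- by move=> _ [p [Rp fp pf] ->]; rewrite -!convL_conv // fp pf.
- move=> _ [p [Rp fp pf] ->]; rewrite -convL_conv // => /(convL_inj HA) pp.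
  have [->|p0] := eqVneq p 0; first by left; rewrite linear0.
  have [<-|fp0] := eqVneq p f; first by right.
  case: Hf => _ []; exists p, (f - p); split=> //.
  + split; last by rewrite subr_eq0 eq_sym.
      exact: inRHB.
    by rewrite convBl // !convBr // ff fp pf pp subrr subr0.
  + by rewrite convBr // pf pp subrr.
  + by rewrite convBl // fp pp subrr.
  + by rewrite addrC subrK.
by exists x.
Qed.

(** Against any [q], the trace form sees only w = f q f. Locality and [nilpotent_corner] make y w
    nilpotent, hence of trace zero, and nondegeneracy applies. *)
Let corner_nilpotent y : corner y -> nilpotentmx (convL A y) -> y = 0.
Proof.
move=> cy nily; have [Ry fy yf] := cy.
apply: inRH_nondegenerate => // q Rq.
have -> : pair (y ** q) Lam = pair (y ** (f ** q ** f)) Lam.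
  rewrite -convA // [in RHS]integral_convC -!convA // fy.
  by rewrite -{1}yf.
have cw := corner_ff Rq; set w := f ** q ** f in cw *.
have [a nilZ] := corner_local_conv (corner_mul cy cw).
apply: (mulfI (dim_neq0 lam_Lam)); rewrite mulr0 -convL_trace.
set Z := _ - _ in nilZ.
have yw : convL A w *m convL A y = a *: convL A f + Z.
  by rewrite -convL_conv // addrC subrK.
have fY : convL A f *m convL A y = convL A y by rewrite -convL_conv // yf.
case: (nilpotent_corner fY nily nilZ yw) => [a0|y0].
  by rewrite convL_conv // yw a0 scale0r add0r mxtrace_nilpotent.
by rewrite convL_conv // y0 mulmx0 mxtrace0.
Qed.

Lemma corner_scalar q : R q -> exists a, f ** q ** f = a *: f.
Proof.
move=> Rq; have cx := corner_ff Rq; set x := f ** q ** f in cx *.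
have [a nilx] := corner_local_conv cx; exists a; apply/eqP.
have [Rx fx xf] := cx; rewrite -subr_eq0; apply/eqP/corner_nilpotent.
  split; first by apply/inRHB/inRHZ.
    by rewrite convBr // convZr // fx ff.
  by rewrite convBl // convZl // xf ff.
by rewrite linearB linearZ.
Qed.

Variables (F : 'rV[K]_d) (HF : central_primitive_idem A F) (HfF : f ** F = f).
Variables (m : nat).
Hypothesis Hm : has_dim (fun v => exists q, R q /\ v = f ** q) m.

(** By [corner_scalar], products of f R(H) with R(H) f land on the line of [f]; the trace form makes
    this pairing nondegenerate, so a basis [b] has a dual family. *)
Lemma block_dual_bases : exists a b : 'I_m -> 'rV[K]_d,
  [/\ forall i, exists2 q, R q & a i = q ** f,
      forall i, exists2 q, R q & b i = f ** q,
      forall i j, b j ** a i = (i == j)%:R *: f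
    & F = \sum_i a i ** b i].
Proof.
have [B [Bfree BP]] := Hm.
pose b j := row j B.
have fRB v : (exists2 q, R q & v = f ** q) <-> (v <= B)%MS.
  by rewrite -BP; split=> [[q Rq ->]|[q [Rq ->]]]; exists q.
have Rb j : exists2 q, R q & b j = f ** q by apply/fRB; apply: row_sub.
have ndl x : (exists2 q, R q & x = f ** q) ->
    (forall q, R q -> x ** (q ** f) = 0) -> x = 0.
  move=> [r Rr xE] x0; apply: inRH_nondegenerate => [|q Rq].
    by rewrite xE; apply: inRH_conv.
  have fx : f ** x = x by rewrite xE -convA // ff.
  by rewrite -fx convA // integral_convC convA // x0 // pair0l.
have ndr x : (exists2 q, R q & x = q ** f) ->
    (forall q, R q -> (f ** q) ** x = 0) -> x = 0.
  move=> [r Rr xE] x0; apply: inRH_nondegenerate => [|q Rq].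
    by rewrite xE; apply: inRH_conv.
  have xf : x ** f = x by rewrite xE convA // ff.
  by rewrite -xf convA // integral_convC x0 // pair0l.
(* The coordinate vectors realised by elements of R(H) f: a covector killing them all gives an
   element of f R(H) orthogonal to R(H) f. *)
pose P (u : 'rV[K]_m) := exists2 a, (exists2 q, R q & a = q ** f) &
   forall j, b j ** a = u 0 j *: f.
have Pall u : P u.
  apply: subspace_full u => [|c u v [a [q Rq aE] ba] [a' [q' Rq' aE'] ba']|c c0].
  - exists 0 => [|j]; last by rewrite conv0r mxE scale0r.
    by exists 0; [apply: inRH0 | rewrite conv0l].
  - exists (c *: a + a') => [|j].
      exists (c *: q + q'); first by apply/inRHD/Rq'/inRHZ.
      by rewrite convDl // convZl // aE aE'.
    by rewrite convDr // convZr // ba ba' !mxE scalerDl scalerA.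
  have : c^T *m B = 0.
    apply: ndl; first by apply/fRB/submxMl.
    move=> q Rq.
    have cb j : exists x, b j ** (q ** f) = x *: f.
      have [r Rr ->] := Rb j.
      have [|x fx] := @corner_scalar (r ** q); first exact: inRH_conv.
      by exists x; rewrite -fx -!convA.
    have [u ub] := choice cb.
    have Pu : P (\row_j u j).
      exists (q ** f); first by exists q.
      by move=> j; rewrite ub mxE.
    have /matrixP /(_ 0 0) := c0 _ Pu; rewrite [LHS]mxE [RHS]mxE => uc0.
    rewrite mulmx_sum_row conv_suml //.
    transitivity ((\sum_j (\row_j u j) 0 j * c j 0) *: f); last first.
      by rewrite uc0 scale0r.
    rewrite scaler_suml; apply: eq_bigr => j _.
    by rewrite convZl // ub scalerA !mxE mulrC.
  move=> cB; apply: trmx_inj; apply: (row_free_inj Bfree).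
  by rewrite /= cB trmx0 mul0mx.
have [a aP] := choice (fun i => let: ex_intro2 x p q := Pall (delta_mx 0 i) in
   ex_intro (fun x => (exists2 q, R q & x = q ** f) /\
     forall j, b j ** x = (delta_mx 0 i : 'rV_m) 0 j *: f) x (conj p q)).
have ba i j : b j ** a i = (i == j)%:R *: f.
  by rewrite (aP i).2 mxE eqxx /= eq_sym.
exists a, b; split=> //; first by move=> i; case: (aP i).
(* [F'] is a right unit on f R(H) and a left unit on R(H) f. This makes it a central idempotent
   below [F], and then primitivity of [F] forces equality. *)
set F' := \sum_i _.
have RF' : R F'.
  apply: inRH_sum => i _; have [q Rq ->] := (aP i).1; have [r Rr ->] := Rb i.
  by do ! apply: inRH_conv.
have bF' x : (exists2 q, R q & x = f ** q) -> x ** F' = x.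
  move/fRB/submxP => [c ->]; rewrite mulmx_sum_row conv_suml //.
  apply: eq_bigr => j _; rewrite convZl //; congr (_ *: _).
  rewrite -[row j B]/(b j) conv_sumr (bigD1 j) //= big1 => [|i ij].
    rewrite addr0 -convA // ba eqxx scale1r; have [q Rq ->] := Rb j.
    by rewrite -convA // ff.
  by rewrite -convA // ba (negPf ij) scale0r conv0l.
have F'a x : (exists2 q, R q & x = q ** f) -> F' ** x = x.
  move=> [q Rq xE]; apply/eqP; rewrite -subr_eq0; apply/eqP/ndr.
    exists (F' ** q - q); first by apply/inRHB/Rq/inRH_conv.
    by rewrite convBl // convA // -xE.
  move=> r Rr; rewrite convBr // -convA // bF' ?subrr //.
  by exists r.
have cF' : central_RH A F'.
  move=> q Rq.
  have e1 : F' ** q = F' ** q ** F'.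
    rewrite {1 2}/F' !conv_suml //; apply: eq_bigr => i _.
    rewrite !convA // -[b i ** (q ** F')]convA // bF' //.
    by have [r Rr ->] := Rb i; exists (r ** q); [apply: inRH_conv | rewrite convA].
  have e2 : q ** F' = F' ** q ** F'.
    rewrite {1 3}/F' !conv_sumr //; apply: eq_bigr => i _.
    rewrite -!convA // [F' ** q ** _]convA // F'a //.
    have [r Rr ->] := (aP i).1.
    by exists (q ** r); [apply: inRH_conv | rewrite convA].
  by rewrite e1 e2.
have [[RF FF F0] cF Fprim] := HF.
have F'F' : F' ** F' = F'.
  rewrite {2 3}/F' conv_sumr //; apply: eq_bigr => i _.
  by rewrite -convA // F'a //; case: (aP i).
have F'F : F' ** F = F'.
  rewrite /F' conv_suml //; apply: eq_bigr => i _; rewrite convA //.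
  have [q Rq ->] := Rb i; by rewrite convA // -cF // -(convA HA f) HfF.
have FF' : F ** F' = F' by rewrite -cF' // F'F.
have [F'E|F'E] := eqVneq F F'; first by [].
have idF' : idem A R F'.
  split=> //; apply: contraNneq f0 => F'0.
  by rewrite -(bF' f) ?F'0 ?conv0r //; exists f.
case: Fprim; exists F', (F - F'); split.
- by [].
- split.
    split; [exact: inRHB | | by rewrite subr_eq0].
    by rewrite convBl // !convBr // FF F'F FF' F'F' subrr subr0.
  by move=> q Rq; rewrite convBl // convBr // cF // cF'.
- by rewrite convBr // F'F F'F' subrr.
- by rewrite convBl // FF' F'F' subrr.
by rewrite addrC subrK.
Qed.
End Corner.
End CharacterRing.

(** * The Hermitian form on the center *)

Section CommutingProjections.
Variables (K : numClosedFieldType) (t n : nat) (X Y : 'I_t -> 'M[K]_n).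
Hypothesis XX : forall i j, X i *m X j = (i == j)%:R *: X i.
Hypothesis YY : forall i j, Y i *m Y j = (i == j)%:R *: Y i.
Hypothesis XY : forall i j, X i *m Y j = Y j *m X i.
Hypotheses (X1 : \sum_i X i = 1%:M) (Y1 : \sum_i Y i = 1%:M).

(** Joint functional calculus: [c i j] is the eigenvalue on the common image of [X i] and [Y j]. *)
Let comb (c : 'I_t -> 'I_t -> K) := \sum_i \sum_j c i j *: (X i *m Y j).

Let comb_mul c c' : comb c *m comb c' = comb (fun i j => c i j * c' i j).
Proof.
rewrite /comb mulmx_suml; apply: eq_bigr => i _.
rewrite mulmx_suml; apply: eq_bigr => j _.
rewrite mulmx_sumr (bigD1 i) //= [X in _ + X]big1 => [|k ki]; last first.
  rewrite mulmx_sumr big1 // => l _; rewrite -scalemxAl -scalemxAr mulmxA.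
  rewrite -(mulmxA (X i)) -XY (mulmxA (X i)) XX eq_sym (negPf ki).
  by rewrite scale0r !mul0mx !scaler0.
rewrite addr0 mulmx_sumr (bigD1 j) //= big1 => [|l lj]; last first.
  rewrite -scalemxAl -scalemxAr -mulmxA (mulmxA (Y j)) -XY -mulmxA YY.
  by rewrite eq_sym (negPf lj) scale0r !mulmx0 !scaler0.
rewrite addr0 -scalemxAl -scalemxAr scalerA; congr (_ *: _).
by rewrite -mulmxA (mulmxA (Y j)) -XY -mulmxA YY eqxx scale1r mulmxA XX eqxx scale1r.
Qed.

Let tr_comb c : \tr (comb c) = \sum_i \sum_j c i j * (\rank (X i *m Y j))%:R.
Proof.
rewrite raddf_sum; apply: eq_bigr => i _; rewrite raddf_sum; apply: eq_bigr => j _ /=.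
rewrite mxtraceZ mxtrace_idem // -mulmxA (mulmxA (Y j)) -XY -mulmxA YY eqxx.
by rewrite scale1r mulmxA XX eqxx scale1r.
Qed.

Let combX (r : 'I_t -> K) : \sum_i r i *: X i = comb (fun i _ => r i).
Proof.
apply: eq_bigr => i _; rewrite -[X i in LHS]mulmx1 -Y1 mulmx_sumr scaler_sumr.
by [].
Qed.

Let combY (r : 'I_t -> K) : \sum_i r i *: Y i = comb (fun _ j => r j).
Proof.
rewrite /comb exchange_big; apply: eq_bigr => j _ /=.
by rewrite -[Y j in LHS]mul1mx -X1 mulmx_suml scaler_sumr.
Qed.

Let combB c c' : comb c - comb c' = comb (fun i j => c i j - c' i j).
Proof.
rewrite /comb -sumrB; apply: eq_bigr => i _; rewrite -sumrB.
by apply: eq_bigr => j _; rewrite scalerBl.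
Qed.

(** The trace weights joint eigenvalues by the ranks of the [X i *m Y j], which conjugation
    fixes. *)
Lemma tr_conj_combination (r : 'I_t -> K) :
  \tr ((\sum_i (r i)^* *: X i) *m (\sum_i r i *: Y i)) =
  (\tr ((\sum_i r i *: X i) *m (\sum_i (r i)^* *: Y i)))^*.
Proof.
rewrite !combX !combY !comb_mul !tr_comb rmorph_sum; apply: eq_bigr => i _.
rewrite rmorph_sum; apply: eq_bigr => j _.
by rewrite !rmorphM /= conjCK conjC_nat.
Qed.

(** The trace is the sum of |r i - r j| ^ 2 weighted by ranks; if it vanishes, r i = r j wherever
    [X i *m Y j] is nonzero. *)
Lemma tr_combination_ge0 (r : 'I_t -> K) :
  let M := (\sum_i r i *: X i - \sum_i r i *: Y i) *m
    (\sum_i (r i)^* *: X i - \sum_i (r i)^* *: Y i) in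
  0 <= \tr M /\ (\tr M = 0 -> \sum_i r i *: X i = \sum_i r i *: Y i).
Proof.
have ge i j : 0 <= (r i - r j) * ((r i)^* - (r j)^*) * (\rank (X i *m Y j))%:R.
  by rewrite mulr_ge0 ?ler0n // -rmorphB mul_conjC_ge0.
rewrite /= !combX !combY !combB comb_mul tr_comb; split.
  by apply: sumr_ge0 => i _; apply: sumr_ge0 => j _.
move/eqP; rewrite psumr_eq0 => [/allP z|i _]; last by apply: sumr_ge0.
apply/eqP; rewrite -subr_eq0 combB; apply/eqP; rewrite /comb big1 // => i _.
rewrite big1 // => j _.
have := z i (mem_index_enum _); rewrite psumr_eq0 // => /allP /(_ j (mem_index_enum _)).
rewrite -rmorphB mulf_eq0 mul_conjC_eq0 => /orP[/eqP->|]; first by rewrite scale0r.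
by rewrite pnatr_eq0 mxrank_eq0 => /eqP->; rewrite scaler0.
Qed.
End CommutingProjections.

(** * Conjugation on the center and the trace criterion for the left kernel *)

Section LeftKernel.
Variables (K : numClosedFieldType) (d : nat) (A : hopf_data K d).
Hypotheses (HA : is_hopf A) (Hss : semisimple A).
Local Notation E i := (basis_vec K i).
Local Notation L := (mulL A).
Local Notation mul := (hmul A).
Local Notation "p ** q" := (conv A p q) (at level 40, left associativity).
#[local] Opaque comul hmul conv harp.
Variables Lam lam : 'rV[K]_d.
Hypotheses (HLam : integral_H A Lam) (Hlam : integral_Hstar A lam).
Hypothesis lam_Lam : pair lam Lam = 1.
Hypothesis lam_one : pair lam (hone A) = d%:R.
Local Notation D := (comul A Lam).
Local Notation R := (inRH A).
Variables (N : nat) (Vs : 'I_N -> hmodule K d).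
Hypothesis irr : forall k, irreducible A (Vs k).
Hypothesis lamE : lam = \sum_k character (Vs k).
Local Notation chi_ k := (character (Vs k)).
Local Notation n_ k := (mdim (Vs k)).

Let repM k x y : rep (Vs k) (mul x y) = rep (Vs k) x *m rep (Vs k) y.
Proof. by have [[rM _] _ _] := irr k; apply: rM. Qed.
Let rep1 k : rep (Vs k) (hone A) = 1%:M.
Proof. by have [[_ r1] _ _] := irr k. Qed.
Let n0 k : (n_ k)%:R != 0 :> K.
Proof. by have [_ npos _] := irr k; rewrite pnatr_eq0 -lt0n. Qed.

Lemma eq_rep x y : (forall k, rep (Vs k) x = rep (Vs k) y) -> x = y.
Proof.
move=> xy; apply/eqP; rewrite -subr_eq0; apply/eqP.
apply: (eq0_integral HA HLam Hlam lam_Lam) => w.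
rewrite lamE pair_suml big1 // => k _.
by rewrite pair_character repM linearB /= xy subrr mul0mx mxtrace0.
Qed.

Let central z := forall x, mul z x = mul x z.
Let zeta z k := pair (chi_ k) z / (n_ k)%:R.

Lemma rep_central z k : central z -> rep (Vs k) z = (zeta z k)%:M.
Proof.
move=> zC; have [h|a za] := schur (irr k) (M := rep (Vs k) z).
  by rewrite -!repM zC.
by rewrite /zeta pair_character za mxtrace_scalar -[a *+ _]mulr_natr mulfK.
Qed.

(* Products of [z - s]; normalised, they are the spectral idempotents of [z]. *)
Let lagrange z (l : seq K) := foldr (fun s u => mul (z - s *: hone A) u) (hone A) l.

Let rep_lagrange z l k : central z ->
  rep (Vs k) (lagrange z l) = (\prod_(s <- l) (zeta z k - s))%:M.
Proof.
move=> zC; elim: l => [|s l IH] /=; first by rewrite big_nil rep1.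
rewrite repM IH big_cons linearB linearZ /= rep1 rep_central //.
by rewrite scalemx1 -raddfB /= -scalar_mxM.
Qed.

(** Lagrange interpolation in [z] at its distinct scalars on the [Vs k] gives [eps i], equal to 1
    where [z] acts by [r i] and to 0 elsewhere. The last clause says that the conjugate combination
    acts by conjugate scalars. *)
Lemma central_spectral z : central z -> exists (t : nat) (r : 'I_t -> K)
  (eps : 'I_t -> 'rV[K]_d),
  [/\ forall i j, mul (eps i) (eps j) = (i == j)%:R *: eps i,
      forall i, central (eps i), \sum_i eps i = hone A,
      z = \sum_i r i *: eps i
    & forall k, pair (chi_ k) (\sum_i (r i)^* *: eps i) = (pair (chi_ k) z)^*].
Proof.
move=> zC; pose rs := undup [seq zeta z k | k <- enum 'I_N].
have rsU : uniq rs by apply: undup_uniq.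
have zrs k : zeta z k \in rs.
  by rewrite mem_undup; apply: map_f; rewrite mem_enum.
pose r (i : 'I_(size rs)) := nth 0 rs i.
have r_in i : r i \in rs by apply: mem_nth.
pose eps i := (\prod_(s <- rem (r i) rs) (r i - s))^-1 *: lagrange z (rem (r i) rs).
have rep_eps k i : rep (Vs k) (eps i) = (zeta z k == r i)%:R%:M.
  rewrite /eps linearZ /= rep_lagrange // scale_scalar_mx; congr (_%:M).
  have [->|zr] := eqVneq (zeta z k) (r i).
    rewrite mulVf // prodf_seq_neq0; apply/allP=> s.
    by rewrite mem_rem_uniq // inE => /andP[sr _]; rewrite subr_eq0 eq_sym.
  have zin : zeta z k \in rem (r i) rs by rewrite mem_rem_uniq // inE zr zrs.
  by rewrite [X in _ * X](big_rem _ zin) /= subrr mul0r mulr0.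
have r_inj : injective r by move=> i j /eqP; rewrite nth_uniq // => /eqP/val_inj.
have sum_eps k (c : 'I_(size rs) -> K) i : zeta z k = r i ->
    rep (Vs k) (\sum_i c i *: eps i) = (c i)%:M.
  move=> zi; rewrite linear_sum (bigD1 i) //= big1 => [|j ji].
    by rewrite linearZ /= rep_eps zi eqxx addr0 scalemx1.
  by rewrite linearZ /= rep_eps zi (inj_eq r_inj) eq_sym (negPf ji) scale_scalar_mx mulr0 raddf0.
have zi k : exists i, zeta z k = r i.
  have ltk : (index (zeta z k) rs < size rs)%N by rewrite index_mem.
  by exists (Ordinal ltk); rewrite /r nth_index.
exists (size rs), r, eps; split.
- move=> i j; apply: eq_rep => k; rewrite repM [RHS]linearZ /= !rep_eps -scalar_mxM.
  rewrite scale_scalar_mx; congr (_%:M).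
  have [->|ij] := eqVneq i j; first by case: eqP; rewrite ?mulr0 ?mul1r.
  case: eqP => [->|]; last by rewrite mul0r mulr0.
  by rewrite (inj_eq r_inj) (negPf ij) mulr0 mul0r.
- move=> i x; apply: eq_rep => k; rewrite !repM rep_eps.
  by rewrite scalar_mxC.
- apply: eq_rep => k; have [i e] := zi k.
  transitivity (rep (Vs k) (\sum_i 1 *: eps i)).
    by congr (rep _ _); apply: eq_bigr => j _; rewrite scale1r.
  by rewrite (sum_eps _ _ _ e) rep1.
- apply: eq_rep => k; have [i e] := zi k.
  by rewrite (sum_eps _ _ _ e) rep_central // e.
move=> k; have [i e] := zi k; rewrite !pair_character (sum_eps _ _ _ e).
rewrite rep_central // !mxtrace_scalar e.
by rewrite -mulr_natr -[r i *+ _]mulr_natr rmorphM /= conjC_nat.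
Qed.

(** For central [z] this is lam (w zb), where zb is the conjugate of [z]; isomorphic modules may
    recur among the [Vs k]. *)
Definition hermitian_form w z : K :=
  \sum_k pair (chi_ k) w * (pair (chi_ k) z)^* / (n_ k)%:R.

Variable V : hmodule K d.
Hypothesis HV : is_module A V.
Local Notation n := (mdim V).
Local Notation Reg := (regular_module A).

Local Notation partial_trace := (partial_trace A V).

Lemma tr_tens_regular h u :
  \tr (rep (tens_module A Reg V) h *m (rep Reg u *t 1%:M)) =
  pair lam (mul (partial_trace h) u).
Proof.
rewrite rep_tens // /tens_map mulmx_suml raddf_sum /=.
rewrite [partial_trace h]row_sum_basis hmul_suml // pair_sumr.
apply: eq_bigr => i _; rewrite hmulZl // pairZr mxE mulr_suml.
rewrite mulmx_suml raddf_sum /=; apply: eq_bigr => j _.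
rewrite -scalemxAl mxtraceZ tensmx_mul mxtrace_tens mulmx1.
have [regM _] := regular_is_module HA.
rewrite -regM -(pair_character Reg) -(pair_character V).
rewrite -(integral_character HA Hss HLam Hlam lam_Lam lam_one) pair_basis.
by rewrite [_^T _ _]mxE; ring.
Qed.

(** Evaluating both operators at 1 (x) v gives h_1 (x) h_2 v = h (x) v. *)
Lemma eq_tens_regular_LKer h :
  rep (tens_module A Reg V) h = rep Reg h *t 1%:M -> LKer A V h.
Proof.
move=> /(congr1 (fun M => M *m ((hone A)^T *t (1%:M : 'M_n)))).
rewrite tensmx_mul mulmx1 rep_regular_tr hmul1r // rep_tens // /tens_map.
move=> eh v a.
have e : \sum_i \sum_j comul A h i j *: ((E i)^T *t mact V j) = h^T *t 1%:M.
  rewrite -eh mulmx_suml; apply: eq_bigr => i _.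
  rewrite mulmx_suml; apply: eq_bigr => j _.
  by rewrite -scalemxAl tensmx_mul mulmx1 rep_regular_tr hmul1r // rep_basis.
have -> : h 0 a *: v = (h 0 a)%:M *m v by rewrite mul_scalar_mx.
transitivity ((\sum_b comul A h a b *: mact V b) *m v).
  by rewrite mulmx_suml; apply: eq_bigr => b _; rewrite scalemxAl.
congr (_ *m v); apply/matrixP=> x y.
move/matrixP: e => /(_ (mxtens_index (a, x)) (mxtens_index (0, y))).
rewrite tensmxE summxE => e; rewrite [RHS]mxE -mulr_natr.
move: e; rewrite [h^T _ _]mxE [(1%:M) _ _]mxE => <-; rewrite summxE.
rewrite [RHS](bigD1 a) //= [X in _ + X]big1 ?addr0 => [|i ia].
  rewrite summxE; apply: eq_bigr => j _.
  by rewrite mxE [RHS]mxE tensmxE !mxE !eqxx mul1r.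
rewrite summxE; apply: big1 => j _.
by rewrite mxE tensmxE !mxE eqxx /= eq_sym (negPf ia) mul0r mulr0.
Qed.

Let Xop h := rep (tens_module A Reg V) h.
Let Yop h : 'M[K]_(d * n) := rep Reg h *t 1%:M.

Let tensV : is_module A (tens_module A Reg V).
Proof. by apply: tens_is_module => //; apply: regular_is_module. Qed.

Let XM x y : Xop (mul x y) = Xop x *m Xop y. Proof. by case: tensV. Qed.
Let YM x y : Yop (mul x y) = Yop x *m Yop y.
Proof. by rewrite /Yop (regular_is_module HA).1 tensmx_mul mulmx1. Qed.

Let Xsum I r (P : pred I) (f : I -> 'rV[K]_d) :
  Xop (\sum_(i <- r | P i) f i) = \sum_(i <- r | P i) Xop (f i).
Proof. exact: linear_sum. Qed.
Let Ysum I r (P : pred I) (f : I -> 'rV[K]_d) :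
  Yop (\sum_(i <- r | P i) f i) = \sum_(i <- r | P i) Yop (f i).
Proof. by rewrite /Yop linear_sum tensmx_suml. Qed.
Let XZ c x : Xop (c *: x) = c *: Xop x. Proof. exact: linearZ. Qed.
Let YZ c x : Yop (c *: x) = c *: Yop x.
Proof. by rewrite /Yop linearZ tensmxZl. Qed.

Let XYC z x : central z -> Xop x *m Yop z = Yop z *m Xop x.
Proof.
move=> zC; rewrite /Xop /Yop rep_tens // /tens_map mulmx_suml mulmx_sumr.
apply: eq_bigr => i _; rewrite mulmx_suml mulmx_sumr; apply: eq_bigr => j _.
rewrite -scalemxAl -scalemxAr !tensmx_mul mulmx1 mul1mx.
by rewrite -!(regular_is_module HA).1 zC.
Qed.

(** [s] is the expanded trace of |Delta z - z (x) 1| ^ 2 on H (x) V: each square contributes n times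
    the norm of [z], the diagonal one by [rep_regular_tens], and the cross terms are [c] and its
    conjugate. *)
Lemma LKer_central z : central z ->
  let c := hermitian_form (partial_trace z) z in
  let s := n%:R * hermitian_form z z *+ 2 - c - c^* in
  0 <= s /\ (s = 0 -> LKer A V z).
Proof.
move=> zC; have [t [r [eps [epsM epsC eps1 zE zbE]]]] := central_spectral zC.
set zb := \sum_i _ in zbE.
have zbC : central zb.
  move=> x; rewrite /zb hmul_suml // hmul_sumr //; apply: eq_bigr => i _.
  by rewrite hmulZl // hmulZr // epsC.
have form w : hermitian_form w z = pair lam (mul w zb).
  rewrite -zbC lamE pair_suml; apply: eq_bigr => k _.
  by rewrite (character_central (irr k)) // zbE [_^* * _]mulrC.
have lamReg := integral_character HA Hss HLam Hlam lam_Lam lam_one.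
have X1 : \sum_i Xop (eps i) = 1%:M by rewrite -Xsum eps1; case: tensV.
have Y1 : \sum_i Yop (eps i) = 1%:M.
  by rewrite -Ysum eps1 /Yop (regular_is_module HA).2 tensmx1.
have XX i j : Xop (eps i) *m Xop (eps j) = (i == j)%:R *: Xop (eps i).
  by rewrite -XM epsM XZ.
have YY i j : Yop (eps i) *m Yop (eps j) = (i == j)%:R *: Yop (eps i).
  by rewrite -YM epsM YZ.
have XYe i j : Xop (eps i) *m Yop (eps j) = Yop (eps j) *m Xop (eps i).
  exact: XYC.
have Xz : Xop z = \sum_i r i *: Xop (eps i).
  by rewrite [in LHS]zE Xsum; apply: eq_bigr => i _; rewrite XZ.
have Yz : Yop z = \sum_i r i *: Yop (eps i).
  by rewrite [in LHS]zE Ysum; apply: eq_bigr => i _; rewrite YZ.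
have Xzb : Xop zb = \sum_i (r i)^* *: Xop (eps i).
  by rewrite Xsum; apply: eq_bigr => i _; rewrite XZ.
have Yzb : Yop zb = \sum_i (r i)^* *: Yop (eps i).
  by rewrite Ysum; apply: eq_bigr => i _; rewrite YZ.
have := tr_combination_ge0 XX YY XYe X1 Y1 r.
have trXbY := tr_conj_combination XX YY XYe X1 Y1 r.
rewrite -Xz -Yz -Xzb -Yzb /= in trXbY *.
have -> : \tr ((Xop z - Yop z) *m (Xop zb - Yop zb)) =
    n%:R * hermitian_form z z *+ 2 - hermitian_form (partial_trace z) z
     - (hermitian_form (partial_trace z) z)^*.
  rewrite mulmxBl !mulmxBr -XM -YM -(XYC zb zC) !linearB /= trXbY.
  rewrite tr_tens_regular -form rep_regular_tens // mxtrace_tens mxtrace1.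
  rewrite -!pair_character -lamReg -form [_ * n%:R]mulrC mulr2n.
  by ring.
by case=> s0 sz; split=> // /sz; apply: eq_tens_regular_LKer.
Qed.
End LeftKernel.

(** * Closure properties of the left kernel *)

Section LKerClosure.
Variables (K : fieldType) (d : nat) (A : hopf_data K d).
Hypothesis HA : is_hopf A.
Local Notation "p ** q" := (conv A p q) (at level 40, left associativity).
#[local] Opaque comul hmul conv harp.

Lemma harp_conv h p q : harp A h (p ** q) = harp A (harp A h p) q.
Proof.
by apply: pair_inj => r; rewrite pairC [RHS]pairC !pair_harp convA.
Qed.

Variable V : hmodule K d.

Lemma LKer0 : LKer A V 0.
Proof.
move=> v a; rewrite big1 ?mxE ?scale0r // => b _.
by rewrite linear0 mxE scale0r.
Qed.

Lemma LKerD x y : LKer A V x -> LKer A V y -> LKer A V (x + y).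
Proof.
move=> kx ky v a; rewrite mxE scalerDl -kx -ky -big_split; apply: eq_bigr => b _.
by rewrite linearD mxE scalerDl.
Qed.

Lemma LKerZ c x : LKer A V x -> LKer A V (c *: x).
Proof.
move=> kx v a; rewrite mxE -scalerA -kx scaler_sumr; apply: eq_bigr => b _.
by rewrite linearZ mxE scalerA.
Qed.

Lemma LKer_sum I r (P : pred I) (f : I -> 'rV[K]_d) :
  (forall i, P i -> LKer A V (f i)) -> LKer A V (\sum_(i <- r | P i) f i).
Proof.
by move=> kf; apply: big_rec => [|i x Pi kx]; [apply: LKer0 | apply/LKerD/kx/kf].
Qed.

(** Apply Delta to the first leg of x_1 (x) x_2 v = x (x) v, then [p] to the new first factor. *)
Lemma LKer_harp x p : LKer A V x -> LKer A V (harp A x p).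
Proof.
move=> kx v a.
have coassoc i b : \sum_c comul A x i c * comulc A c a b =
    \sum_c comul A x c b * comulc A c i a by have [_ [_ [/(_ x i a b) <-]]] := HA.
transitivity (\sum_i \sum_b (p 0 i * \sum_c comul A x i c * comulc A c a b) *:
    (mact V b *m v)).
  rewrite exchange_big; apply: eq_bigr => b _ /=; rewrite -scaler_suml.
  congr (_ *: _); rewrite comulE harpE.
  under [RHS]eq_bigr do rewrite mulr_sumr.
  rewrite [RHS]exchange_big; apply: eq_bigr => c _ /=; rewrite mxE mulr_suml.
  by apply: eq_bigr => i _; rewrite mulrA.
rewrite harpE mxE scaler_suml; apply: eq_bigr => i _.
under eq_bigr do rewrite coassoc -scalerA.
rewrite -scaler_sumr -scalerA; congr (_ *: _).
under eq_bigr do rewrite scaler_suml.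
rewrite exchange_big /= comulE scaler_suml; apply: eq_bigr => c _.
rewrite -scalerA [in RHS]scalerA mulrC -scalerA -kx scaler_sumr.
by apply: eq_bigr => b _; rewrite !scalerA mulrC.
Qed.

Lemma partial_trace_LKer h :
  LKer A V h -> partial_trace A V h = (mdim V)%:R *: h.
Proof.
move=> kh; apply/rowP=> a; rewrite !mxE.
have e : \sum_b comul A h a b *: mact V b = (h 0 a)%:M.
  apply/trmx_inj/row_matrixP=> j; rewrite -!tr_col; congr (_^T); rewrite !colE mul_scalar_mx -kh mulmx_suml.
  by apply: eq_bigr => b _; rewrite scalemxAl.
have := congr1 mxtrace e; rewrite mxtrace_scalar mulr_natl => <-.
rewrite [RHS]raddf_sum /=; apply: eq_bigr => b _.
by rewrite mxtraceZ [character V _ _]mxE [_^T _ _]mxE mulrC.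
Qed.

Lemma pair_partial_trace q h : pair q (partial_trace A V h) = pair (q ** character V) h.
Proof.
rewrite pair_conv pairE trmx_mul trmxK mulmxA.
by [].
Qed.
End LKerClosure.

(** * The equivalence for a block of R(H) *)

Section MainTheorem.
Variables (K : numClosedFieldType) (d : nat) (A : hopf_data K d).
Hypotheses (HA : is_hopf A) (Hss : semisimple A).
Local Notation "p ** q" := (conv A p q) (at level 40, left associativity).
#[local] Opaque comul hmul conv harp.
Variables Lam lam : 'rV[K]_d.
Hypotheses (HLam : integral_H A Lam) (Hlam : integral_Hstar A lam).
Hypothesis lam_Lam : pair lam Lam = 1.
Hypothesis lam_one : pair lam (hone A) = d%:R.
Local Notation D := (comul A Lam).
Local Notation R := (inRH A).
Variables (V : hmodule K d) (HV : irreducible A V).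
Local Notation chi := (character V).
Local Notation n := (mdim V).

(** By cyclicity of evaluation at [Lam], p r chi and chi p r agree there. Partial trace on central
    elements thus mirrors multiplication by [chi] on R(H). *)
Lemma partial_trace_harp p :
  partial_trace A V (harp A Lam p) = harp A Lam (chi ** p).
Proof.
apply: pair_inj => r; rewrite pairC pair_partial_trace [RHS]pairC !pair_harp.
rewrite -convA // (integral_convC HA Hss HLam Hlam lam_Lam lam_one).
by rewrite -convA.
Qed.

Section Character.
Variables (N : nat) (Vs : 'I_N -> hmodule K d).
Hypothesis irr : forall k, irreducible A (Vs k).
Hypothesis lamE : lam = \sum_k character (Vs k).

(* Coordinates in which [hermitian_form] is the standard Hermitian form. *)
Definition character_matrix : 'M[K]_(d, N) :=
  \matrix_(i, k) (character (Vs k) 0 i / sqrtC (mdim (Vs k))%:R).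
Local Notation Q := character_matrix.

Lemma mul_character_matrix x k :
  (x *m Q) 0 k = pair (character (Vs k)) x / sqrtC (mdim (Vs k))%:R.
Proof.
rewrite mxE mulr_suml; apply: eq_bigr => i _.
by rewrite mxE mulrA [x _ _ * _]mulrC.
Qed.

Lemma hermitian_formE w z :
  hermitian_form Vs w z = (w *m Q *m (map_mx Num.conj (z *m Q))^T) 0 0.
Proof.
rewrite [RHS]mxE; apply: eq_bigr => k _.
rewrite mul_character_matrix mxE mxE mul_character_matrix rmorphM /= fmorphV.
have s0 : 0 <= sqrtC (mdim (Vs k))%:R :> K by rewrite sqrtC_ge0 ler0n.
rewrite /= (CrealP (ger0_real s0)) mulrACA -invfM -expr2 sqrtCK.
by [].
Qed.

(** The rows of [a] span a [chi]-stable space with matrix [beta]. Its trace does not depend on the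
    basis, so an orthonormal one may be used in [LKer_central]; nonnegative terms of sum zero all
    vanish. *)
Lemma LKer_of_trace m (a : 'M[K]_(m, d)) (beta : 'M[K]_m) :
  row_free a -> (forall i, R (row i a)) ->
  a *m convL A chi = beta *m a -> \tr beta = (m * n)%:R ->
  forall i, LKer A V (harp A Lam (row i a)).
Proof.
move=> afree Ra Tbeta trbeta.
have Rlin (u : 'rV_m) : R (u *m a).
  by rewrite mulmx_sum_row; apply: inRH_sum => i _; apply: inRHZ.
have cen p : R p -> forall x, hmul A (harp A Lam p) x = hmul A x (harp A Lam p).
  by move=> Rp x; apply: (harp_central HA Hss HLam Hlam lam_Lam lam_one).
pose M := a *m D *m Q.
(* The Lam <- (u *m a) are central, hence determined by their character values, so passing to the
   coordinates [Q] loses nothing. *)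
have Mfree : row_free M.
  apply: inj_row_free => u; rewrite /M !mulmxA => uM.
  suff ua0 : u *m a = 0 by apply: (row_free_inj afree); rewrite /= ua0 mul0mx.
  apply: (harp_inj HA HLam Hlam lam_Lam); rewrite [RHS]harpE mul0mx.
  apply: (eq_rep HA HLam Hlam lam_Lam irr lamE) => k.
  rewrite (rep_central irr k (cen _ (Rlin u))) harpE linear0.
  have := mul_character_matrix (u *m a *m D) k; rewrite uM mxE.
  move=> /esym/eqP; rewrite mulf_eq0 invr_eq0 sqrtC_eq0.
  have [_ npos _] := irr k; rewrite pnatr_eq0 eqn0Ngt npos orbF => /eqP ->.
  by rewrite mul0r raddf0.
have mN : (m <= N)%N by rewrite -(eqP Mfree) rank_leq_col.
have /unitarymxP SS := schmidt_unitarymx M mN.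
set Sm := schmidt M in SS.
have [U SU] : exists U, Sm = U *m M.
  by apply/submxP; rewrite (eqmx_schmidt_free Mfree).
have [C MC] : exists C, M = C *m Sm.
  by apply/submxP; rewrite (eqmx_schmidt_free Mfree).
have CU : C *m U = 1%:M.
  by apply: (row_free_inj Mfree); rewrite /= -mulmxA -SU -MC mul1mx.
(* [a'] is the orthonormalised basis and [B], similar to [beta], the matrix of [chi] in it; its
   diagonal entries are the cross terms of [LKer_central]. *)
pose a' := U *m a; pose B := U *m beta *m C.
have aE : a = C *m a' by rewrite /a' mulmxA CU mul1mx.
have Ba : a' *m convL A chi = B *m a'.
  by rewrite /a' -mulmxA Tbeta /B -!mulmxA [C *m _]mulmxA CU mul1mx.
have aQ : a' *m D *m Q = Sm by rewrite SU /a' /M !mulmxA.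
have rowE' i : row i a' = row i U *m a by rewrite /a' row_mul.
have Ra' i : R (row i a') by rewrite rowE'.
have zQ i : harp A Lam (row i a') *m Q = row i Sm.
  by rewrite harpE -aQ !row_mul.
have tQ i : partial_trace A V (harp A Lam (row i a')) *m Q = row i B *m Sm.
  by rewrite partial_trace_harp harpE convLE -(row_mul i a') Ba row_mul -aQ
    (mulmxA (row i B) (a' *m D) Q) (mulmxA (row i B) a' D).
have SSt : Sm *m (map_mx Num.conj Sm)^T = 1%:M by rewrite -SS map_trmx.
have row_conj (X : 'M[K]_(m, N)) i :
    (row i X *m (map_mx Num.conj (row i Sm))^T) 0 0 = (X *m (map_mx Num.conj Sm)^T) i i.
  rewrite mxE [RHS]mxE; apply: eq_bigr => k _.
  by rewrite !mxE.
have key i := LKer_central HA Hss HLam Hlam lam_Lam lam_one irr lamE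
  (let: And3 x _ _ := HV in x) (cen _ (Ra' i)).
have form1 i : hermitian_form Vs (harp A Lam (row i a')) (harp A Lam (row i a')) = 1.
  by rewrite hermitian_formE zQ row_conj SSt mxE eqxx.
have formB i : hermitian_form Vs (partial_trace A V (harp A Lam (row i a')))
    (harp A Lam (row i a')) = B i i.
  by rewrite hermitian_formE tQ zQ -row_mul row_conj -mulmxA SSt mulmx1.
have trB : \tr B = (m * n)%:R by rewrite /B -mulmxA mxtrace_mulC -mulmxA CU mulmx1.
have ge0 i : 0 <= n%:R * 1 *+ 2 - B i i - (B i i)^*.
  by have [] := key i; rewrite /= formB form1.
have sum0 : \sum_i (n%:R * 1 *+ 2 - B i i - (B i i)^* : K) = 0.
  rewrite !sumrB -rmorph_sum -/(\tr B) trB /= conjC_nat sumr_const card_ord.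
  by rewrite natrM -[_ *+ m]mulr_natr; ring.
have ker i : LKer A V (harp A Lam (row i a')).
  have [_] := key i; rewrite /= formB form1; apply.
  move/eqP: sum0; rewrite psumr_eq0 // => /allP /(_ i (mem_index_enum _)).
  by move/eqP.
move=> i; rewrite aE row_mul mulmx_sum_row.
have -> : harp A Lam (\sum_j row i C 0 j *: row j a') =
    \sum_j row i C 0 j *: harp A Lam (row j a').
  rewrite harpE mulmx_suml; apply: eq_bigr => j _.
  by rewrite harpE scalemxAl.
by apply: LKer_sum => j _; apply: LKerZ.
Qed.
End Character.

Variables (F f : 'rV[K]_d).
Hypotheses (HF : central_primitive_idem A F) (Hf : primitive_idem A f).
Hypothesis HfF : f ** F = f.
Variables (m e : nat).
Hypothesis Hm : has_dim (fun v => exists q, R q /\ v = f ** q) m.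
Hypothesis He : has_dim (fun v => exists q : 'rV[K]_d, v = f ** q) e.

Let f0 : f != 0. Proof. by case: Hf => [[]]. Qed.
Let ff : f ** f = f. Proof. by case: Hf => [[]]. Qed.
Let RF : R F. Proof. by case: HF => [[]]. Qed.
Let Rchi : R chi. Proof. exact: inRH_char. Qed.
Let cF : central_RH A F. Proof. by case: HF. Qed.
Let moduleV : is_module A V. Proof. by case: HV. Qed.

Let convL_rank : \rank (convL A f) = e.
Proof.
have [B [/eqP rkB BP]] := He; rewrite -[RHS]rkB; apply/eqP; rewrite eqn_leq; apply/andP; split; apply/mxrankS/row_subP => i.
  by apply/BP; exists (row i 1%:M); rewrite convLE -row_mul mul1mx.
have [q ->] := (BP _).2 (row_sub i B).
by rewrite convLE submxMl.
Qed.

(** Both are the trace of the idempotent [convL A f], whose row space is f H^*. *)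
Let pair_f : d%:R * pair f Lam = e%:R.
Proof.
rewrite -(convL_trace HA Hss HLam Hlam lam_Lam lam_one) mxtrace_idem ?convL_rank //.
by rewrite -convL_conv // ff.
Qed.

Let e0 : e%:R != 0 :> K.
Proof.
rewrite pnatr_eq0 -convL_rank mxrank_eq0; apply: contraNneq f0 => Lf0.
by apply/eqP/(convL_inj HA); rewrite Lf0 linear0.
Qed.

Lemma idempotent_character_equiv :
  let eta := e%:R^-1 *: harp A Lam (d%:R *: F) in
  (F ** chi = pair chi (hone A) *: F <->
     pair chi eta = m%:R * pair chi (hone A)) /\
  (pair chi eta = m%:R * pair chi (hone A) <->
     forall p : 'rV[K]_d, LKer A V (harp A Lam (F ** p))).
Proof.
move=> eta; rewrite pair_character1 //.
have [a [b [Ra Rb ba FE]]] :=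
  block_dual_bases HA Hss HLam Hlam lam_Lam lam_one Hf HF HfF Hm.
have [beta betaP] : exists beta : 'M[K]_m, forall i j, b j ** (chi ** a i) = beta i j *: f.
  have ex i j : exists x, b j ** (chi ** a i) = x *: f.
    have [q Rq ->] := Ra i; have [r Rr ->] := Rb j.
    have [|x xP] := corner_scalar HA Hss HLam Hlam lam_Lam lam_one Hf (q := r ** chi ** q).
      by do 2! apply: inRH_conv => //.
    by exists x; rewrite -xP !convA.
  have ex2 i : exists g : 'I_m -> K, forall j, b j ** (chi ** a i) = g j *: f.
    by have [g gP] := choice (ex i); exists g.
  have [g gP] := choice ex2.
  by exists (\matrix_(i, j) g i j) => i j; rewrite gP mxE.
have Fa i : F ** a i = a i.
  have [q Rq ->] := Ra i.
  rewrite -convA // cF // convA // -[F ** f]/(conv A F f) cF ?HfF //.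
  by case: Hf => [[]].
have chia i : chi ** a i = \sum_j beta i j *: a j.
  rewrite -[in LHS]Fa -convA // -cF // convA // [in LHS]FE conv_suml //.
  apply: eq_bigr => j _; rewrite convA // betaP convZr //.
  by congr (_ *: _); have [q Rq ->] := Ra j; rewrite convA // ff.
(* Cyclicity turns a_i b_i chi into b_i chi a_i, a multiple of [f] by [beta i i]; then [pair_f]
   cancels the normalisation of [eta]. *)
have pair_eta : pair chi eta = \tr beta.
  rewrite /eta pairZr pair_harp convZl // pairZl FE conv_suml // pair_suml.
  rewrite mulr_sumr mulr_sumr; apply: eq_bigr => i _.
  rewrite convA // (integral_convC HA Hss HLam Hlam lam_Lam lam_one) convA //.
  by rewrite betaP pairZl [d%:R * _]mulrCA pair_f mulrCA mulVf ?mulr1.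
rewrite pair_eta.
have i_ii : F ** chi = n%:R *: F -> \tr beta = m%:R * n%:R.
  move=> Fchi; rewrite mulr_natl -[X in _ *+ X]card_ord -sumr_const.
  apply: eq_bigr => i _.
  have chin : chi ** a i = n%:R *: a i.
    by rewrite -{1}(Fa i) -convA // -cF // Fchi convZl // Fa.
  have := betaP i i; rewrite chin convZr // ba eqxx scale1r => /eqP.
  rewrite -subr_eq0 -scalerBl scaler_eq0 (negPf f0) orbF subr_eq0 eq_sym.
  by move/eqP.
have ii_iii : \tr beta = m%:R * n%:R -> forall p, LKer A V (harp A Lam (F ** p)).
  have [N [Vs [irr lamE]]] := integral_series HA Hss HLam Hlam lam_Lam lam_one.
  (* Lam <- (a_i b_i p) is (Lam <- a_i) <- (b_i p), so by [LKer_harp] only the Lam <- a_i matter. *)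
  move=> trb p; rewrite FE conv_suml //.
  rewrite harpE mulmx_suml; apply: LKer_sum => i _; rewrite -harpE convA // harp_conv //.
  apply: LKer_harp => //.
  pose am : 'M[K]_(m, d) := \matrix_i a i.
  have -> : a i = row i am by rewrite rowK.
  apply: (LKer_of_trace irr lamE (beta := beta)).
  - apply: inj_row_free => u; rewrite mulmx_sum_row => u0; apply/rowP=> j; rewrite mxE.
    have := congr1 (conv A (b j)) u0; rewrite conv0r conv_sumr // (bigD1 j) //=.
    rewrite big1 => [|k kj]; rewrite convZr // rowK ba.
      by rewrite eqxx scale1r addr0 => /eqP; rewrite scaler_eq0 (negPf f0) orbF => /eqP.
    by rewrite (negPf kj) scale0r scaler0.
  - move=> j; rewrite rowK; have [q Rq ->] := Ra j; apply: inRH_conv => //.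
    by case: Hf => [[]].
  - apply/row_matrixP=> j; rewrite !row_mul rowK -convLE chia mulmx_sum_row.
    by apply: eq_bigr => k _; rewrite rowK mxE.
  by rewrite trb natrM.
(* Taking [p] to be the counit puts Lam <- F in the kernel; its partial trace is both n (Lam <- F)
   and Lam <- (chi F). *)
have iii_i : (forall p, LKer A V (harp A Lam (F ** p))) -> F ** chi = n%:R *: F.
  move=> /(_ (counitc A)); rewrite conv1r // => /partial_trace_LKer.
  rewrite partial_trace_harp cF // => e1.
  by apply: (harp_inj HA HLam Hlam lam_Lam); rewrite e1 !harpE scalemxAl.
by split; split=> // h; [apply/iii_i/ii_iii | apply/i_ii/iii_i].
Qed.
End MainTheorem.

From mathcomp Require Import reals complex.

Theorem theorem3p6 (R : realType) (d : nat) (A : hopf_data R[i] d)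
  (HA : is_hopf A) (Hss : semisimple A)
  (Lam lam : 'rV[R[i]]_d)
  (HLam : integral_H A Lam) (Hlam : integral_Hstar A lam)
  (Hlam_Lam : pair lam Lam = 1)
  (HF0 : conv A (d%:R^-1 *: lam) (d%:R^-1 *: lam) = d%:R^-1 *: lam)
  (V : hmodule R[i] d) (HV : irreducible A V)
  (F f : 'rV[R[i]]_d) (HF : central_primitive_idem A F)
  (Hf : primitive_idem A f) (HfF : conv A f F = f)
  (m e : nat)
  (Hm : has_dim (fun v => exists q, inRH A q /\ v = conv A f q) m)
  (He : has_dim (fun v => exists q : 'rV[R[i]]_d, v = conv A f q) e) :
  let chi := character V in
  let eta := e%:R^-1 *: harp A Lam (d%:R *: F) in
  (conv A F chi = pair chi (hone A) *: F <->
     pair chi eta = m%:R * pair chi (hone A)) /\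
  (pair chi eta = m%:R * pair chi (hone A) <->
     forall p : 'rV[R[i]]_d, LKer A V (harp A Lam (conv A F p))).
Proof.
have d0 := dim_neq0 Hlam_Lam.
(* As [lam] convolved with itself is lam (1) times [lam], idempotency of lam / d fixes lam (1). *)
have lam_one : pair lam (hone A) = d%:R.
  move: HF0; rewrite convZl convZr (Hlam lam).1 !scalerA => /eqP.
  rewrite -subr_eq0 -scalerBl scaler_eq0 => /orP[|/eqP lam0]; last first.
    by move: Hlam_Lam; rewrite lam0 pair0l => /eqP; rewrite eq_sym oner_eq0.
  rewrite -mulrA -[X in _ - X]mulr1 -mulrBr mulf_eq0 invr_eq0 (negPf d0) /= subr_eq0.
  by move=> /eqP/(canRL (mulVKf d0)); rewrite mulr1.
exact: (idempotent_character_equiv HA Hss HLam Hlam Hlam_Lam lam_one HV HF Hf HfF).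
Qed.
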